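(* Let $g=\frac{\sqrt5-1}{2}$ and let $\mathcal{E}\subset[0,1]$ be the bifurcation set of the Tanaka-Ito family $(T_\alpha)_{\alpha\in[0,1]}$. Then \begin{align*} \mathcal{E}\cap[g,1] &=\big\{\alpha\in[g,1]:\ T_\alpha^n(\alpha-1)\le\tfrac{1}{\alpha+1}\ \text{and}\ T_\alpha^n(\tfrac1\alpha-1)\le\tfrac{1}{\alpha+1}\ \text{for all } n\ge1\big\}\\ &=\big\{\alpha\in[g,1]:\ T_g^n(\alpha-1)\ge\alpha-1\ \text{and}\ T_g^n(\tfrac1\alpha-1)\ge\alpha-1\ \text{for all } n\ge1\big\}\\ &=\big\{\alpha\in[g,1]:\ T_1^n(\alpha)\notin(\tfrac{1}{\alpha+1},\alpha)\ \text{for all } n\ge2,\ \text{and}\ T_1^n(\alpha)\notin(1-\alpha,\tfrac{\alpha}{\alpha+1})\\ &\qquad\qquad\qquad\ \text{for all } n\ge2\ \text{such that } P_n(\alpha)\ \text{is odd}\big\}, \end{align*} where $P_n(\alpha)=\min\{k\ge0:\ T_1^{n-k}(\alpha)\le1-\alpha\ \text{or}\ T_1^{n-k-1}(\alpha)\ge\alpha\}$.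
   Context: For $\alpha\in[0,1]$ the Tanaka-Ito map $T_\alpha:[\alpha-1,\alpha]\to[\alpha-1,\alpha]$ is defined by $T_\alpha(0)=0$ and $T_\alpha(x)=\frac1x-\left\lfloor\frac1x+1-\alpha\right\rfloor$ for $x\ne0$; $T_\alpha^n$ is its $n$-th iterate, $T_\alpha^0$ the identity. $T_1$ is the Gauss map on $[0,1]$. A non-empty open interval $J\subset[0,1]$ is a matching interval with matching exponents $M,N$ (positive integers) if $T_\alpha^M(\alpha-1)=T_\alpha^N(\alpha)$ for all $\alpha\in J$, $T_\alpha^{M-1}(\alpha-1)\ne T_\alpha^{N-1}(\alpha)$ for Lebesgue-almost all $\alpha\in J$, and $J$ is not contained in a larger open interval with these properties (for the same $M,N$). The matching set is the union of all matching intervals, and the bifurcation set $\mathcal{E}$ is the complement of the matching set in $[0,1]$. In the definition of $P_n(\alpha)$, $k$ ranges over $0\le k\le n-1$; the minimum exists because $T_1^0(\alpha)=\alpha\geq\alpha$. *)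

(* Defs.v *)
From HB Require Import structures.
From mathcomp Require Import all_boot all_order all_algebra.
From mathcomp Require Import all_classical all_reals all_analysis.

Set Implicit Arguments.
Unset Strict Implicit.
Unset Printing Implicit Defensive.

Import Order.TTheory GRing.Theory Num.Theory.
Import numFieldNormedType.Exports.

Local Open Scope classical_set_scope.
Local Open Scope ring_scope.

(* A total function on R; for 0 <= a <= 1 it maps [a - 1, a] to itself, and it
   is only meant to be used there. *)
Definition tanaka_ito (R : realType) (a x : R) : R :=
  if x == 0 then 0 else x^-1 - (Num.floor (x^-1 + 1 - a))%:~R.

Definition tanaka_ito_iter (R : realType) (a : R) (n : nat) (x : R) : R :=
  iter n (tanaka_ito a) x.

(* The requirements on a matching interval other than maximality. Open means
   open in R, so J contains neither 0 nor 1. *)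
Definition pre_matching_interval (R : realType) (M N : nat) (J : set R) :=
  [/\ J !=set0 /\ J `<=` `[0, 1],
      open J /\ is_interval J,
      forall a, J a ->
        tanaka_ito_iter a M (a - 1) = tanaka_ito_iter a N a &
      {ae @lebesgue_measure R, forall a, J a ->
        tanaka_ito_iter a M.-1 (a - 1) <> tanaka_ito_iter a N.-1 a}].

Definition matching_interval (R : realType) (M N : nat) (J : set R) :=
  pre_matching_interval M N J /\
  forall K : set R, pre_matching_interval M N K -> J `<=` K -> K = J.

Definition matching_set (R : realType) : set R :=
  [set a | exists M N (J : set R),
    [/\ (0 < M)%N, (0 < N)%N, matching_interval M N J & J a]].
Arguments matching_set : clear implicits.

Definition bifurcation_set (R : realType) : set R :=
  `[0, 1] `\` matching_set R.
Arguments bifurcation_set : clear implicits.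

(* The least k < n satisfying the condition; for 0 < n it is met by n.-1.
   Outside of this range the value is the dummy 0. *)
Definition P_index (R : realType) (n : nat) (a : R) : nat :=
  find (fun k => (tanaka_ito_iter 1 (n - k) a <= 1 - a)
              || (a <= tanaka_ito_iter 1 (n - k - 1) a))
       (iota 0 n).

Definition golden (R : realType) : R := (Num.sqrt 5 - 1) / 2.

(* Main.v *)
Require Import Defs.
From mathcomp Require Import all_boot all_order all_algebra.
From mathcomp Require Import all_classical all_reals all_analysis.
From mathcomp Require Import ring lra zify.

Set Implicit Arguments.
Unset Strict Implicit.
Unset Printing Implicit Defensive.

Import Order.TTheory GRing.Theory Num.Theory.
Import numFieldNormedType.Exports.

Local Open Scope classical_set_scope.
Local Open Scope ring_scope.

(* Fix a in (g, 1) and follow x_n = T_a^n(a - 1), y_n = T_a^n(1/a - 1). They start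
   with x + y + xy = 0 and, as long as both stay at most 1/(a + 1), satisfy one of
   x + y = 0, x + y = 1, x + y + xy = 0. The first time that one of them exceeds
   1/(a + 1) the sum is 1, and the orbits merge with exponents determined by that
   time; these are recovered from a matching interval at any of its points that is
   neither rational nor quadratic. If neither orbit ever exceeds 1/(a + 1), then
   near a there are parameters with arbitrarily late merging, or with two different
   merging times: the orbits expand in a, so a parameter where they meet a - 1
   separates its two sides, and such parameters accumulate where they meet 0.
   Hence a is in the bifurcation set. The orbits then avoid (1/(a + 1), a), so they
   are also orbits of T_g, and up to sign and modulo 1 they follow that of a
   under T_1. *)

(** The obstacle is that a matching interval fixes its exponents only through an identity and an
    almost-everywhere inequality, so they cannot be read off at an arbitrary parameter: eventually
    periodic orbits may meet at many pairs of times. At a generic parameter a later iterate of an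
    orbit point $x$ is never $x$, nor $c - x$ with $c$ an integer. The first fact leaves a single
    pair of exponents; both together forbid orbits that meet while their sum is an integer at
    arbitrarily late times. Generic parameters miss only a countable set, so every interval has one
    outside any given null set. A parameter where no orbit exceeds the bound is then excluded from
    matching intervals by contradiction: exponents would be constant around it, yet merging times
    near it are unbounded or take two values. The end points g and 1 escape this scheme. Just left
    of g the exponents are (3, 3), which the merging times just right of g do not produce; and 1
    lies in no open subset of [0, 1]. *)

Section Digits.
Context {R : realType}.
Implicit Types (a x y u : R) (m k : int).

Lemma tanaka_ito0 a : tanaka_ito a 0 = 0.
Proof. by rewrite /tanaka_ito eqxx. Qed.

(** A half-open interval of length 1 meets each class modulo the integers once, so naming the digit
    [m] certifies a value of the map. *)
Lemma tanaka_ito_char a x u m : (u + m%:~R) * x = 1 -> a - 1 <= u < a ->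
  tanaka_ito a x = u.
Proof.
move=> ux /andP[u1 u2].
have x0 : x != 0 by apply: contra_eq_neq ux => ->; rewrite mulr0 eq_sym oner_neq0.
have xV : x^-1 = u + m%:~R by apply: (mulIf x0); rewrite mulVf.
rewrite /tanaka_ito (negbTE x0) xV.
rewrite (_ : Num.floor _ = m) ?addrK //.
by apply: floor_def; rewrite intrD; lra.
Qed.

Lemma tanaka_ito_spec a x : x != 0 ->
  exists m, (tanaka_ito a x + m%:~R) * x = 1 /\ a - 1 <= tanaka_ito a x < a.
Proof.
move=> x0; exists (Num.floor (x^-1 + 1 - a)).
rewrite /tanaka_ito (negbTE x0) subrK mulVf//; split=> //.
have /andP[] := floor_itv (x^-1 + 1 - a).
by rewrite intrD => h1 h2; lra.
Qed.

Lemma tanaka_ito_ge_lt a x : 0 < a <= 1 -> a - 1 <= tanaka_ito a x < a.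
Proof.
move=> a01; have [->|/(tanaka_ito_spec a)[m []]//] := eqVneq x 0.
by rewrite tanaka_ito0; lra.
Qed.

Lemma tanaka_ito_modZ a x y m : x != 0 -> y != 0 -> x^-1 - y^-1 = m%:~R ->
  tanaka_ito a x = tanaka_ito a y.
Proof.
move=> x0 y0 xy; have [k [ky yr]] := tanaka_ito_spec a y0.
apply: (@tanaka_ito_char _ _ _ (k + m)) => //.
have -> : x = y / (1 + m%:~R * y) by rewrite -xy; field; rewrite x0 y0.
rewrite intrD addrA mulrA mulrDl ky -xy.
by field; rewrite x0 y0.
Qed.

Lemma int_01 m : -1 < m%:~R :> R -> m%:~R < 2 :> R -> m = 0 \/ m = 1.
Proof.
move=> h1 h2.
have : (-1 < m)%R by rewrite -(ltr_int R).
have : (m < 2)%R by rewrite -(ltr_int R).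
lia.
Qed.

End Digits.

(** The interval (g, 1) in a polynomial form that [lra] and [nra] can use; g is the positive root of
    $a^2 + a = 1$. *)
Definition regular (R : realType) (a : R) := [/\ 1 / 2 < a, a < 1 & 1 < a * a + a].

(** * Relations between two points that one step of the map preserves *)

Section States.
Context {R : realType}.
Implicit Types a x y : R.
Local Notation T := tanaka_ito.

Definition sum01 x y := x + y = 0 \/ x + y = 1.
(** The equation is $(1+x)(1+y)=1$, or $1/x+1/y=-1$ away from 0. The bounds put both points below
    $1/a-1$, or at it, and this is less than $1/(a+1)$. *)
Definition linked a x y := [/\ x + y + x * y = 0, a * x <= 1 - a & a * y <= 1 - a].
Definition state a x y := sum01 x y \/ linked a x y.
Definition low a x := x * (a + 1) <= 1.

Lemma T_range a x : regular a -> a - 1 <= T a x < a.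
Proof. by case=> ha a1 _; apply: tanaka_ito_ge_lt; lra. Qed.

(** The images have an integral sum in $[2a-2, 2a)$, and $1/2 < a < 1$ leaves only 0 and 1 there. *)
Lemma T_sum01 a x y : regular a -> x != 0 -> y != 0 ->
  (exists k : int, x^-1 + y^-1 = k%:~R) -> sum01 (T a x) (T a y).
Proof.
move=> [ha a1 _] x0 y0 [k xyk].
have [m [mx /andP[xl xu]]] := tanaka_ito_spec a x0.
have [n [ny /andP[yl yu]]] := tanaka_ito_spec a y0.
have xV : x^-1 = T a x + m%:~R by apply: (mulIf x0); rewrite mulVf.
have yV : y^-1 = T a y + n%:~R by apply: (mulIf y0); rewrite mulVf.
have e : T a x + T a y = (k - m - n)%:~R by rewrite !intrB -xyk xV yV; ring.
have [||h|h] := @int_01 R (k - m - n); rewrite -?e; [lra..| |].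
- by left; rewrite e h.
- by right; rewrite e h.
Qed.

Lemma sum0_step a x y : regular a -> x + y = 0 -> sum01 (T a x) (T a y).
Proof.
move=> ra xy; have yx : y = - x by lra.
have [x0|x0] := eqVneq x 0.
  by rewrite yx x0 oppr0 tanaka_ito0; left; rewrite addr0.
apply: T_sum01 => //; first by rewrite yx oppr_eq0.
by exists 0; rewrite yx invrN subrr.
Qed.

Lemma linked_step a x y : regular a -> linked a x y -> sum01 (T a x) (T a y).
Proof.
move=> ra [xy _ _].
have [x0|x0] := eqVneq x 0.
  have y0 : y = 0 by move: xy; rewrite x0; lra.
  by rewrite x0 y0 tanaka_ito0; left; rewrite addr0.
have y0 : y != 0.
  by apply: contra_neq x0 => y0; move: xy; rewrite y0; lra.
apply: T_sum01 => //; exists (-1).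
have -> : x^-1 + y^-1 = (x + y) / (x * y) by field; rewrite x0 y0.
have -> : x + y = - (x * y) by lra.
by rewrite mulNr divff ?mulf_neq0.
Qed.

(** Here $x$ lies between $a/(a+1)$ and $1/(a+1)$, so $a+1 \le 1/x \le 1+1/a < a+2$ and the digit is
    2. *)
Lemma T_middle a x y : regular a -> low a x -> low a y -> x + y = 1 ->
  0 < x /\ (T a x + 2) * x = 1.
Proof.
rewrite /low => -[ha a1 ga] lx ly xy.
have x0 : 0 < x by nra.
split=> //.
have -> : T a x = x^-1 - 2.
  apply: (@tanaka_ito_char _ _ _ _ 2); first by rewrite subrK mulVf ?gt_eqF.
  have h1 : a + 1 <= x^-1 by rewrite -div1r ler_pdivlMr//; lra.
  have h2 : x^-1 < a + 2 by rewrite -div1r ltr_pdivrMr//; nra.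
  by lra.
by rewrite subrK mulVf ?gt_eqF.
Qed.

(** Both digits are 2, so $1 + T_a x = (1-x)/x = y/x$ and $1 + T_a y = x/y$, whose product is 1. *)
Lemma sum1_step a x y : regular a -> low a x -> low a y -> x + y = 1 ->
  linked a (T a x) (T a y).
Proof.
move=> ra lx ly xy.
have [x0 Tx] := T_middle ra lx ly xy.
have [y0 Ty] := T_middle ra ly lx (etrans (addrC _ _) xy).
move: lx ly ra; rewrite /low => lx ly [ha a1 ga].
have xy0 : x * y != 0 by rewrite gt_eqF// mulr_gt0.
split.
- have : (T a x + T a y + T a x * T a y) * (x * y) = 0.
    have -> : (T a x + T a y + T a x * T a y) * (x * y) =
      ((T a x + 2) * x - x) * ((T a y + 2) * y - y) - x * y by ring.
    by rewrite Tx Ty; nra.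
  by move/eqP; rewrite mulf_eq0 (negbTE xy0) orbF => /eqP.
- have : (a * T a x) * x <= (1 - a) * x by nra.
  by rewrite ler_pM2r.
- have : (a * T a y) * y <= (1 - a) * y by nra.
  by rewrite ler_pM2r.
Qed.

Lemma sum0_lt a x y : regular a -> a - 1 <= y -> x + y = 0 -> x * (a + 1) < 1.
Proof. by case=> ? ? ? ? ?; nra. Qed.

Lemma linked_lt a x y : regular a -> linked a x y -> x * (a + 1) < 1.
Proof. by move=> [? ? ?] [_ h _]; nra. Qed.

Lemma state_step a x y : regular a -> low a x -> low a y -> state a x y ->
  state a (T a x) (T a y).
Proof.
move=> ra lx ly [[xy|xy]|xy].
- by left; exact: sum0_step.
- by right; exact: sum1_step.
- by left; exact: linked_step xy.
Qed.

Lemma T_low_bound a x : regular a -> x * (a + 1) = 1 -> T a x = a - 1.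
Proof.
move=> [ha a1 _] h; apply: (@tanaka_ito_char _ _ _ _ 2); last by lra.
by rewrite -[RHS]h; ring.
Qed.

(** The digit of $x$ is 1, so $T_a x = y/x$; its reciprocal $x/y = 1/y - 1$ differs from $1/y$ by an
    integer. *)
Lemma T_high a x y : regular a -> 1 < x * (a + 1) -> x < a -> x + y = 1 ->
  T a (T a x) = T a y /\ T a x != y.
Proof.
move=> [ha a1 ga] hx xa xy.
have x0 : 0 < x by nra.
have x1 : 0 < 1 - x by lra.
have Tx : T a x = x^-1 - 1.
  apply: (@tanaka_ito_char _ _ _ _ 1); first by rewrite subrK mulVf ?gt_eqF.
  have h1 : x^-1 < a + 1 by rewrite -div1r ltr_pdivrMr//; nra.
  have h2 : a <= x^-1 by rewrite -div1r ler_pdivlMr//; nra.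
  by lra.
have Tx' : T a x = (1 - x) / x by rewrite Tx; field; rewrite gt_eqF.
have -> : y = 1 - x by lra.
split.
- apply: (@tanaka_ito_modZ _ _ _ _ (-1)); rewrite ?Tx' ?mulf_neq0 ?invr_eq0 ?gt_eqF//.
  by field; rewrite !gt_eqF.
- by rewrite Tx' gt_eqF// ltr_pdivlMr//; nra.
Qed.

End States.

(** * The two orbits, their merging, and the events that merging excludes *)

Section Orbits.
Context {R : realType}.
Implicit Types a x y : R.
Local Notation T := tanaka_ito.

(** For regular [a] the orbit with index [true] starts at $1/a-1 = T_a(a)$, one step into the orbit
    of [a]. *)
Definition orb (b : bool) a n := tanaka_ito_iter a n (if b then 1 / a - 1 else a - 1).

Lemma orbS b a n : orb b a n.+1 = T a (orb b a n).
Proof. by []. Qed.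

Lemma T_self a : regular a -> T a a = 1 / a - 1.
Proof.
case=> ha a1 ga; have a0 : 0 < a by lra.
apply: (@tanaka_ito_char _ _ _ _ 1); first by field; rewrite gt_eqF.
have h1 : 1 / a < a + 1 by rewrite ltr_pdivrMr//; lra.
have h2 : 1 <= 1 / a by rewrite ler_pdivlMr//; lra.
by lra.
Qed.

Lemma iter_right a n : regular a -> tanaka_ito_iter a n.+1 a = orb true a n.
Proof. by move=> ra; rewrite /orb /tanaka_ito_iter iterSr T_self. Qed.

Lemma orb_range b a n : regular a -> a - 1 <= orb b a n < a.
Proof.
move=> ra; case: n => [|n]; last by rewrite orbS; exact: T_range.
case: b; rewrite /orb /tanaka_ito_iter /=.
  by rewrite -T_self//; exact: T_range.
by case: ra => *; lra.
Qed.

Definition low_before a m := forall b j, (j < m)%N -> low a (orb b a j).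
Definition matched b a m := low_before a m /\ 1 < orb b a m * (a + 1).

Lemma low_beforeW a m n : (n <= m)%N -> low_before a m -> low_before a n.
Proof. by move=> nm h b j jn; apply: h; exact: leq_trans nm. Qed.

Lemma state_sym a x y : state a x y -> state a y x.
Proof.
rewrite /state /sum01 (addrC y) => -[?|[h1 h2 h3]]; [by left|right; split=> //].
by rewrite mulrC (addrC y).
Qed.

Lemma orb_linked0 a : regular a -> linked a (orb false a 0) (orb true a 0).
Proof.
case=> ha a1 ga; have a0 : a != 0 by rewrite gt_eqF//; lra.
rewrite /orb /tanaka_ito_iter /=; split.
- by field.
- nra.
- by rewrite mulrBr mulr1 mulrC divfK.
Qed.

Lemma orb_state b a m : regular a -> low_before a m ->
  state a (orb b a m) (orb (~~ b) a m).
Proof.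
move=> ra lm; wlog -> : b / b = false.
  by move=> h; case: b; [apply: state_sym|]; exact: h.
elim: m lm => [|m IH] lm; first by right; exact: orb_linked0.
rewrite !orbS; apply: state_step => //; [exact: lm..|].
by apply: IH; exact: low_beforeW lm.
Qed.

Lemma matched_sum1 b a m : regular a -> matched b a m ->
  orb b a m + orb (~~ b) a m = 1.
Proof.
move=> ra [lm hm]; have [[h|//]|h] := orb_state b ra lm.
- have /andP[r _] := orb_range (~~ b) m ra.
  by have := sum0_lt ra r h; lra.
- by have := linked_lt ra h; lra.
Qed.

(** By [T_high] the orbit that exceeds the bound at time [m] needs [m.+2] steps and the other one
    [m.+1]; counting from [a] instead of $T_a(a)$ adds one to the second exponent. *)
Definition exponents (b : bool) (m : nat) : nat * nat :=
  if b then (m.+1, m.+3) else (m.+2, m.+2).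

Lemma matched_exponents b a m : regular a -> matched b a m ->
  let: (M, N) := exponents b m in
  tanaka_ito_iter a M (a - 1) = tanaka_ito_iter a N a /\
  tanaka_ito_iter a M.-1 (a - 1) <> tanaka_ito_iter a N.-1 a.
Proof.
move=> ra mm; have s1 := matched_sum1 ra mm; case: mm => lm hm.
have /andP[_ r] := orb_range b m ra.
have [] := T_high ra hm r s1.
case: b lm hm s1 r => lm hm s1 r e1 e2.
  change (orb false a m.+1 = tanaka_ito_iter a m.+3 a /\
          orb false a m <> tanaka_ito_iter a m.+2 a).
  rewrite !iter_right// !orbS e1; split=> //.
  by move=> e; move: e2; rewrite e eqxx.
change (orb false a m.+2 = tanaka_ito_iter a m.+2 a /\
        orb false a m.+1 <> tanaka_ito_iter a m.+1 a).
rewrite !iter_right// !orbS; split=> //.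
by move/eqP; exact/negP.
Qed.

Lemma T_restart a : regular a -> T a (1 - a) = T a (1 / a - 1).
Proof.
case=> ha a1 ga; have a0 : a != 0 by rewrite gt_eqF//; lra.
have a1' : 1 - a != 0 by rewrite gt_eqF//; lra.
have e : 1 / a - 1 = (1 - a) / a by field.
apply: (@tanaka_ito_modZ _ _ _ _ 1) => //; rewrite e ?mulf_neq0 ?invr_eq0//.
by field; rewrite a0 a1'.
Qed.

Lemma hit_partner b a j : regular a -> low_before a j -> orb b a j = a - 1 ->
  orb (~~ b) a j = 1 - a \/ orb (~~ b) a j = 1 / a - 1.
Proof.
move=> ra lj h; have := orb_state b ra lj; rewrite h.
have /andP[_ r] := orb_range (~~ b) j ra.
case: ra => ha a1 ga [[e|e]|[e _ _]].
- by left; lra.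
- by lra.
- right; have a0 : a != 0 by rewrite gt_eqF//; lra.
  by apply: (mulfI a0); rewrite mulrBr mulrCA mulfV//; lra.
Qed.

(** The partner of $a-1$ is $1-a$ or $1/a-1$, and these have the same image. So one step later the
    pair runs through its own beginning again, with the orbit that hit in the role of
    [orb false]. *)
Lemma hit_restart b a j i : regular a -> low_before a j -> orb b a j = a - 1 ->
  orb b a (j + i.+1) = orb false a i.+1 /\ orb (~~ b) a (j + i.+1) = orb true a i.+1.
Proof.
move=> ra lj h; elim: i => [|i [IH1 IH2]]; last by rewrite addnS !orbS IH1 IH2.
rewrite addn1 !orbS h; split=> //.
by have [->|->//] := hit_partner ra lj h; rewrite T_restart.
Qed.

Lemma zero_both b b' a j : regular a -> low_before a j -> orb b a j = 0 ->
  orb b' a j = 0.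
Proof.
move=> ra lj h; have [->//|->] : b' = b \/ b' = ~~ b by case: b b' {h} => -[]; auto.
have := orb_state b ra lj; rewrite h.
have /andP[_ r] := orb_range (~~ b) j ra.
by case: ra => ha a1 ga [[e|e]|[e _ _]]; lra.
Qed.

Definition nonzero_before a m := forall b j, (j < m)%N -> orb b a j != 0.
(** Time 0 is left out because [orb false a 0] is $a-1$ itself. *)
Definition nohit_upto a m := forall b j, (0 < j <= m)%N -> orb b a j != a - 1.

(** Zero occurs in both orbits at once and is a fixed point, so it would persist up to time [m]. *)
Lemma matched_nonzero b a m : regular a -> matched b a m -> nonzero_before a m.+1.
Proof.
move=> ra [lm hm] b' j; rewrite ltnS => jm; apply/eqP => /(zero_both b ra (low_beforeW jm lm)) z.
suff z' i : orb b a (j + i) = 0.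
  by move: hm; rewrite -(subnKC jm) z' mul0r ltr10.
elim: i => [|i IH]; first by rewrite addn0.
by rewrite addnS orbS IH tanaka_ito0.
Qed.

Lemma matched_nohit b a m : regular a -> matched b a m -> nohit_upto a m.
Proof.
move=> ra [lm hm] b' j /andP[j0 jm]; apply/eqP => h.
have lj := low_beforeW jm lm.
have [e|/subnKC e] : j = m \/ (j < m)%N by move: jm; rewrite leq_eqVlt => /orP[/eqP|]; auto.
  move: hm; rewrite -e.
  have [->|->] : b = b' \/ b = ~~ b' by case: b b' {h} => -[]; auto.
    by rewrite h; case: ra => ha a1 ga; apply/negP; rewrite -leNgt; nra.
  apply/negP; rewrite -leNgt; apply/ltW.
  have [->|->] := hit_partner ra lj h; case: ra => ha a1 ga; first by nra.
  have a0 : 0 < a by lra.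
  have -> : (1 / a - 1) * (a + 1) = (1 - a * a) / a by field; rewrite gt_eqF.
  by rewrite ltr_pdivrMr//; lra.
(* After a hit at [j] the values at time [m] repeat those at [m - j], a positive time before [m],
   where both orbits are low. *)
have [r1 r2] := hit_restart (m - j.+1) ra lj h.
move: r1 r2; rewrite addnS -addSn e => r1 r2.
have lt : ((m - j.+1).+1 < m)%N by lia.
have l1 := lm false _ lt; have l2 := lm true _ lt.
have : low a (orb b a m).
  have [->|->] : b = b' \/ b = ~~ b' by case: (b) (b') => -[]; auto.
    by rewrite r1.
  by rewrite r2.
by move: hm; rewrite /low ltNge => /negP.
Qed.

Lemma low_strict a x : regular a -> low a x -> T a x != a - 1 -> x * (a + 1) < 1.
Proof.
move=> ra lx Tx; rewrite lt_neqAle; apply/andP; split; last exact: lx.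
by apply: contra_neq Tx; exact: T_low_bound.
Qed.

End Orbits.

(** * Parameters whose orbits cannot recur *)

Section Generic.
Context {R : realType}.
Implicit Types a x u : R.

(* Neither rational nor a quadratic irrational. *)
Definition generic x := forall p q r : int,
  p%:~R * x ^+ 2 + q%:~R * x + r%:~R = 0 -> [/\ p = 0, q = 0 & r = 0].

Lemma generic_affine x (p q : int) :
  generic x -> p%:~R * x + q%:~R = 0 -> p = 0 /\ q = 0.
Proof.
move=> gx e; have [|_ -> ->] := gx 0 p q; last by [].
by rewrite mul0r add0r.
Qed.

Lemma generic_neq0 x : generic x -> x != 0.
Proof.
move=> gx; apply/eqP => x0.
have [|//] := @generic_affine x 1 0 gx.
by rewrite x0 mulr0 addr0.
Qed.

Lemma generic_subZ x (m : int) : generic x -> generic (x - m%:~R).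
Proof.
move=> gx p q r e.
have [|-> ] := gx p (q - 2 * p * m) (p * m ^+ 2 - q * m + r).
  by rewrite -[RHS]e !(intrD, intrB, intrM, rmorphXn) /=; ring.
rewrite !(mulr0, mul0r, subr0) => ->.
by rewrite !(mul0r, subr0, add0r) => ->.
Qed.

Lemma generic_invB x u (m : int) : generic x -> (u + m%:~R) * x = 1 -> generic u.
Proof.
move=> gx ux p q r e.
have [|h1 h2 h3] := gx (p * m ^+ 2 - q * m + r) (q - 2 * p * m) p.
  have -> : p%:~R = p%:~R * ((u + m%:~R) * x) ^+ 2 :> R by rewrite ux expr1n mulr1.
  have -> : (q - 2 * p * m)%:~R * x = (q - 2 * p * m)%:~R * x * ((u + m%:~R) * x).
    by rewrite ux mulr1.
  transitivity ((p%:~R * u ^+ 2 + q%:~R * u + r%:~R) * x ^+ 2); last by rewrite e mul0r.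
  by rewrite !(intrD, intrB, intrM, rmorphXn) /=; ring.
move: h1 h2; rewrite h3 !(mulr0, mul0r, subr0) => h1 h2; move: h1.
by rewrite h2 !(mul0r, subr0, add0r) => ->.
Qed.

Lemma generic_T a x : generic x -> generic (tanaka_ito a x).
Proof.
move=> gx; have [m [e _]] := tanaka_ito_spec a (generic_neq0 gx).
exact: generic_invB e.
Qed.

Lemma generic_iter a x n : generic x -> generic (tanaka_ito_iter a n x).
Proof. by move=> gx; elim: n => //= n; exact: generic_T. Qed.

(* The denominator [r x + s] is the product of the first [n] points of the orbit,
   hence it is smaller than [1] in absolute value. *)
Lemma iter_moebius a x n : 0 < a < 1 -> generic x -> `|x| < 1 ->
  exists p q r s : int,
    [/\ tanaka_ito_iter a n x * (r%:~R * x + s%:~R) = p%:~R * x + q%:~R,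
        r%:~R * x + s%:~R != 0 & `|r%:~R * x + s%:~R| <= 1 ?= iff (n == 0%N)].
Proof.
move=> a01 gx x1; elim: n => [|n [p [q [r [s [e D0 [D1 D2]]]]]]].
  exists 1, 0, 0, 1; rewrite mul0r add0r mulr1 mul1r addr0 oner_neq0 normr1.
  by split=> //; exact: leif_refl.
set y := tanaka_ito_iter a n x in e.
have y1 : `|y| < 1.
  rewrite /y; case: n {e D2 y} => [//|n]; rewrite ltr_norml.
  have /andP[] := @tanaka_ito_ge_lt _ a (tanaka_ito_iter a n x) ltac:(lra).
  by rewrite -[tanaka_ito a _]/(tanaka_ito_iter a n.+1 x) => ? ?; lra.
have y0 : y != 0 by apply: generic_neq0; exact: generic_iter.
have [m [my _]] := tanaka_ito_spec a y0.
exists (r - m * p), (s - m * q), p, q; rewrite -e; split.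
- rewrite -[tanaka_ito_iter a n.+1 x]/(tanaka_ito a y).
  rewrite !(intrB, intrM).
  transitivity ((tanaka_ito a y + m%:~R) * y * (r%:~R * x + s%:~R)
     - m%:~R * (y * (r%:~R * x + s%:~R))); first by ring.
  by rewrite my e; ring.
- by rewrite mulf_neq0.
- have lt : `|y * (r%:~R * x + s%:~R)| < 1.
    by rewrite normrM; apply: le_lt_trans y1; rewrite ler_piMr.
  by split; [exact: ltW|rewrite lt_eqF].
Qed.

(** Inserting $ex+c$ into the fractional linear form of the iterate gives a quadratic equation for
    $x$ with leading coefficient $er$. Hence $r = 0$, and the denominator is a nonzero integer of
    absolute value below 1. The cases $e = 1$ and $e = -1$ are the ones applied later. *)
Lemma generic_aperiodic a x n (e c : int) : 0 < a < 1 -> generic x -> `|x| < 1 ->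
  (0 < n)%N -> e != 0 -> tanaka_ito_iter a n x <> e%:~R * x + c%:~R.
Proof.
move=> a01 gx x1 n0 e0 ex.
have [p [q [r [s [h1 D0 [D1 D2]]]]]] := iter_moebius n a01 gx x1.
have [|r0 _ _] := gx (e * r) (e * s + c * r - p) (c * s - q).
  rewrite ex in h1.
  transitivity ((e%:~R * x + c%:~R) * (r%:~R * x + s%:~R) - (p%:~R * x + q%:~R)).
    by rewrite !(intrD, intrB, intrM); ring.
  by rewrite h1 subrr.
have {}r0 : r = 0 by move/eqP: r0; rewrite mulf_eq0 (negbTE e0) => /eqP.
move: D0 D1 D2; rewrite r0 mul0r add0r intr_eq0 -intr_norm.
rewrite (_ : 1 = 1%:~R :> R)// ler_int eqr_int; lia.
Qed.

End Generic.

(** * Generic points outside a null set *)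

Section Density.
Context {R : realType}.
Implicit Types x : R.

Lemma countable_nongeneric : countable [set x : R | ~ generic x].
Proof.
pose f (t : (int * int * int * bool)) : R := let: (p, q, r, b) := t in
  if p == 0 then - (r%:~R / q%:~R) else
  (- q%:~R + (-1) ^+ b * Num.sqrt (q%:~R ^+ 2 - 4 * p%:~R * r%:~R)) / (2 * p%:~R).
apply: (@sub_countable _ _ _ (range f)); last first.
  by apply: sub_countable (card_image_le _ _) _; exact: countableP.
apply: subset_card_le => x /= gx; apply: contrapT => xf; apply: gx => p q r e.
apply: contrapT => npqr; apply: xf.
have [p0|p0] := eqVneq p 0.
  exists (p, q, r, false) => //; rewrite /f p0 eqxx.
  have q0 : q%:~R != 0 :> R.
    rewrite intr_eq0; apply/eqP => q0; apply: npqr; split=> //.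
    by move: e; rewrite p0 q0 !mul0r !add0r => /eqP; rewrite intr_eq0 => /eqP.
  apply: (mulIf q0); rewrite mulNr divfK//.
  by move: e; rewrite p0; lra.
have p0' : p%:~R != 0 :> R by rewrite intr_eq0.
have e2 : (2 * p%:~R * x + q%:~R) ^+ 2 = q%:~R ^+ 2 - 4 * p%:~R * r%:~R.
  transitivity (4 * p%:~R * (p%:~R * x ^+ 2 + q%:~R * x + r%:~R) +
    (q%:~R ^+ 2 - 4 * p%:~R * r%:~R)); first by ring.
  by rewrite e mulr0 add0r.
(* The square root of the discriminant is $|2px+q|$; the boolean restores its sign. *)
exists (p, q, r, 2 * p%:~R * x + q%:~R < 0) => //.
rewrite /f (negbTE p0) -e2 sqrtr_sqr mulr_sign_norm.
by field.
Qed.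

Lemma generic_dense (N : set R) l r : l < r -> (@lebesgue_measure R).-negligible N ->
  exists x, [/\ l < x, x < r, generic x & ~ N x].
Proof.
move=> lr negN; apply: contrapT => H.
have negS : (@lebesgue_measure R).-negligible [set x : R | ~ generic x].
  apply/negligibleP; last exact: countable_lebesgue_measure0 countable_nongeneric.
  by apply: countable_measurable countable_nongeneric => t; exact: measurable_set1.
have : (@lebesgue_measure R).-negligible `]l, r[.
  apply: negligibleS (negligibleU negN negS) => x /=; rewrite in_itv/= => /andP[lx xr].
  have [Nx|Nx] := pselect (N x); [by left|right => gx].
  by apply: H; exists x.
move/measure_negligible => /(_ (measurable_itv _)) m0.
have /eqP : (@lebesgue_measure R `]l, r[ = 0)%E by exact: m0.
rewrite lebesgue_measure_itv /= lte_fin lr -EFinB.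
by rewrite eqe subr_eq0 gt_eqF.
Qed.

End Density.

(** * Continuity and expansion of the orbits in the parameter *)

Section Local.
Context {R : realType}.
Implicit Types (a x y : R) (f : R -> R).
Local Notation T := tanaka_ito.

Lemma regular_near a : regular a -> \forall a' \near a, regular a'.
Proof.
case=> ha a1 ga.
have c : (fun a' : R => a' * a' + a') @ a --> a * a + a.
  by apply: cvgD; [apply: cvgM; exact: cvg_id|exact: cvg_id].
near=> a'; split; near: a'.
- exact: lt_nbhsr.
- exact: lt_nbhsl.
- exact: (cvgr_gt _ c).
Unshelve. all: by end_near. Qed.

Lemma T_near f a m : f @ a --> f a -> (T a (f a) + m%:~R) * f a = 1 ->
  a - 1 < T a (f a) < a ->
  \forall a' \near a, (T a' (f a') + m%:~R) * f a' = 1.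
Proof.
move=> fc e /andP[r1 r2].
have fa0 : f a != 0 by apply: contra_eq_neq e => ->; rewrite mulr0 eq_sym oner_neq0.
have fV : (f a)^-1 = T a (f a) + m%:~R by apply: (mulIf fa0); rewrite mulVf.
have c1 : (fun a' => (f a')^-1 - m%:~R - a') @ a --> (f a)^-1 - m%:~R - a.
  by apply: cvgB; [apply: cvgB; [exact: cvgV|exact: cvg_cst]|exact: cvg_id].
near=> a'.
have f0 : f a' != 0 by near: a'; exact: (cvgr_neq0 _ fc).
have e' : ((f a')^-1 - m%:~R + m%:~R) * f a' = 1 by rewrite subrK mulVf.
have h1 : -1 < (f a')^-1 - m%:~R - a'.
  by near: a'; apply: (cvgr_gt _ c1); rewrite fV; lra.
have h2 : (f a')^-1 - m%:~R - a' < 0.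
  by near: a'; apply: (cvgr_lt _ c1); rewrite fV; lra.
by rewrite (tanaka_ito_char e') //; lra.
Unshelve. all: by end_near. Qed.

(** Away from both ends of the range the digit is constant near [a]. *)
Lemma T_cvg f a : f @ a --> f a -> f a != 0 -> a - 1 < T a (f a) < a ->
  (fun a' => T a' (f a')) @ a --> T a (f a) /\
  exists m : int, T a (f a) = (f a)^-1 - m%:~R /\
    \forall a' \near a, T a' (f a') = (f a')^-1 - m%:~R.
Proof.
move=> fc fa0 r; have [m [e _]] := tanaka_ito_spec a fa0.
have solve x y : x != 0 -> (y + m%:~R) * x = 1 -> y = x^-1 - m%:~R.
  by move=> x0 h; apply: (mulIf x0); rewrite mulrBl mulVf//; lra.
have nT := T_near fc e r.
have nT' : \forall a' \near a, T a' (f a') = (f a')^-1 - m%:~R.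
  near=> a'; apply: solve; last by near: a'.
  by near: a'; exact: (cvgr_neq0 _ fc).
split; last by exists m; split=> //; exact: solve.
rewrite (solve _ _ fa0 e); apply: cvg_trans.
  by apply: near_eq_cvg; near=> a'; symmetry; near: a'; exact: nT'.
by apply: cvgB; [exact: cvgV|exact: cvg_cst].
Unshelve. all: by end_near. Qed.

(** At the lower end the digit may jump: once the branch with digit [m] drops below $a'-1$, the
    digit becomes $m-1$ and the value wraps to the top of the range. *)
Lemma T_near_hit f a m : regular a -> f @ a --> f a ->
  (T a (f a) + m%:~R) * f a = 1 -> T a (f a) = a - 1 ->
  \forall a' \near a, T a' (f a') =
    if a' - 1 <= (f a')^-1 - m%:~R then (f a')^-1 - m%:~R else (f a')^-1 - m%:~R + 1.
Proof.
move=> [ha a1 ga] fc e h.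
have fa0 : f a != 0 by apply: contra_eq_neq e => ->; rewrite mulr0 eq_sym oner_neq0.
have fV : (f a)^-1 = T a (f a) + m%:~R by apply: (mulIf fa0); rewrite mulVf.
have c1 : (fun a' => (f a')^-1 - m%:~R - a') @ a --> (f a)^-1 - m%:~R - a.
  by apply: cvgB; [apply: cvgB; [exact: cvgV|exact: cvg_cst]|exact: cvg_id].
near=> a'.
have f0 : f a' != 0 by near: a'; exact: (cvgr_neq0 _ fc).
have e' : ((f a')^-1 - m%:~R + m%:~R) * f a' = 1 by rewrite subrK mulVf.
have e2 : ((f a')^-1 - m%:~R + 1 + (m - 1)%:~R) * f a' = 1.
  by rewrite intrB -[RHS]e'; congr (_ * _); ring.
have h1 : -2 < (f a')^-1 - m%:~R - a'.
  by near: a'; apply: (cvgr_gt _ c1); rewrite fV h; lra.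
have h2 : (f a')^-1 - m%:~R - a' < 0.
  by near: a'; apply: (cvgr_lt _ c1); rewrite fV h; lra.
by case: leP => h3; [rewrite (tanaka_ito_char e')|rewrite (tanaka_ito_char e2)] => //; lra.
Unshelve. all: by end_near. Qed.

(** For a sign [s] this says that the difference quotients of [f] at [a] have sign [s] and absolute
    value at least 1; the factor $a'-a$ treats both sides together. *)
Definition expanding f (s : R) a :=
  \forall a' \near a, (a' - a) ^+ 2 <= s * (f a' - f a) * (a' - a).

(** Inversion reverses the direction and divides the increment by $f(a')f(a)$, which lies in (0, 1)
    near [a]; this makes the inequality strict. *)
Lemma expanding_inv f s a c : f @ a --> f a -> f a != 0 -> `|f a| < 1 ->
  expanding f s a ->
  \forall a' \near a, a' != a ->
    (a' - a) ^+ 2 < - s * (((f a')^-1 - c) - ((f a)^-1 - c)) * (a' - a).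
Proof.
move=> fc fa0 fa1 fe.
have c1 : (fun a' => f a' * f a) @ a --> f a * f a.
  by apply: cvgM; [exact: fc|exact: cvg_cst].
near=> a'; move=> aa'.
have f0 : f a' != 0 by near: a'; exact: (cvgr_neq0 _ fc).
have h1 : 0 < f a' * f a.
  by near: a'; apply: (cvgr_gt _ c1); rewrite -expr2 exprn_even_gt0.
have h2 : f a' * f a < 1.
  by near: a'; apply: (cvgr_lt _ c1); rewrite -expr2 -real_normK ?num_real// expr_lt1.
have h3 : (a' - a) ^+ 2 <= s * (f a' - f a) * (a' - a) by near: a'.
have h4 : 0 < (a' - a) ^+ 2 by rewrite exprn_even_gt0//= subr_eq0.
have -> : - s * (((f a')^-1 - c) - ((f a)^-1 - c)) * (a' - a) =
    s * (f a' - f a) * (a' - a) / (f a' * f a).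
  by field; rewrite f0 fa0.
apply: le_lt_trans h3 _; rewrite ltr_pdivlMr//.
by rewrite gtr_pMr// (lt_le_trans h4)// ; near: a'.
Unshelve. all: by end_near. Qed.

Lemma orb_norm b a n : regular a -> `|orb b a n| < 1.
Proof.
move=> ra; have := orb_range b n ra; case: ra => ha a1 ga.
by rewrite ltr_norml; lra.
Qed.

(** The starting points have slopes 1 and $-1/a^2$, and every step reverses the sign; hence the
    exponent [n + b]. *)
Lemma orb_local b a n : regular a -> nonzero_before a n -> nohit_upto a n ->
  (fun a' => orb b a' n) @ a --> orb b a n /\
  expanding (fun a' => orb b a' n) ((-1) ^+ (n + b)) a.
Proof.
move=> ra; elim: n => [|n IH] nz nh.
  have a0 : a != 0 by case: ra => *; rewrite gt_eqF//; lra.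
  have c0 : (fun a' : R => 1 / a' - 1) @ a --> 1 / a - 1.
    by apply: cvgB; [apply: cvgM; [exact: cvg_cst|apply: cvgV => //; exact: cvg_id]|exact: cvg_cst].
  rewrite /orb /tanaka_ito_iter /=; case: b; split.
  - exact: c0.
  - have := @expanding_inv id 1 a 1 (@cvg_id _ _) a0.
    case: (ra) => ha a1 ga.
    have -> : `|id a| < 1 by rewrite /= gtr0_norm//; lra.
    move=> /(_ isT) H; rewrite /expanding add0n expr1.
    have {}H : \forall a' \near a, a' != a ->
      (a' - a) ^+ 2 < - 1 * (((id a')^-1 - 1) - ((id a)^-1 - 1)) * (a' - a).
      by apply: H; near=> a'; rewrite /= mul1r expr2.
    near=> a'; have [->|aa] := eqVneq a' a; first by rewrite !subrr expr0n /= mulr0.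
    by rewrite !div1r; apply: ltW; move: aa; near: a'.
  - by apply: cvgB; [exact: cvg_id|exact: cvg_cst].
  - rewrite /expanding add0n expr0; near=> a'.
    by rewrite mul1r opprB addrA subrK expr2.
have [||fc fe] := IH.
- by move=> b' j jn; apply: nz; exact: ltnW.
- by move=> b' j /andP[j0 jn]; apply: nh; rewrite j0 ltnW.
have f0 : orb b a n != 0 by apply: nz.
have [_ [_ /andP[r1 r2]]] := tanaka_ito_spec a f0.
have r3 : a - 1 < T a (orb b a n) < a.
  by rewrite r2 andbT lt_neqAle r1 andbT eq_sym -orbS; apply: nh; rewrite leqnn.
have [c [m [fV nT]]] := T_cvg fc f0 r3.
split; first exact: c.
have H := expanding_inv m%:~R fc f0 (orb_norm b n ra) fe.
rewrite /expanding addSn exprS mulN1r; near=> a'.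
have [->|aa] := eqVneq a' a; first by rewrite !subrr expr0n /= mulr0.
have e : orb b a' n.+1 = (orb b a' n)^-1 - m%:~R by near: a'.
by rewrite e [orb b a n.+1]fV; apply: ltW; move: aa; near: a'.
Unshelve. all: by end_near. Qed.

End Local.

(** * Recovering the exponents of a matching interval *)

Section Matching.
Context {R : realType}.
Implicit Types (a x y : R).
Local Notation T := tanaka_ito.

Definition strict_before a m := forall b j, (j < m)%N -> orb b a j * (a + 1) < 1.

Lemma strict_of_nohit a m : regular a -> low_before a m -> nohit_upto a m ->
  strict_before a m.
Proof.
move=> ra lm nh b j jm; apply: low_strict => //; first exact: lm.
by rewrite -orbS; apply: nh.
Qed.

Lemma orb_mul_cvg b a n : regular a -> nonzero_before a n -> nohit_upto a n ->
  (fun a' => orb b a' n * (a' + 1)) @ a --> orb b a n * (a + 1).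
Proof.
move=> ra nz nh; apply: cvgM; first by have [] := orb_local b ra nz nh.
by apply: cvgD; [exact: cvg_id|exact: cvg_cst].
Qed.

Lemma nonzero_beforeW a m n : (n <= m)%N -> nonzero_before a m -> nonzero_before a n.
Proof. by move=> nm h b j jn; apply: h; exact: leq_trans nm. Qed.

Lemma nohit_uptoW a m n : (n <= m)%N -> nohit_upto a m -> nohit_upto a n.
Proof. by move=> nm h b j /andP[j0 jn]; apply: h; rewrite j0 (leq_trans jn nm). Qed.

Lemma low_before_near a m : regular a -> nonzero_before a m.-1 -> nohit_upto a m.-1 ->
  strict_before a m -> \forall a' \near a, low_before a' m.
Proof.
move=> ra nz nh st.
suff H n : (n <= m)%N -> \forall a' \near a, low_before a' n by exact: (H m).
elim: n => [|n IH] nm; first by near=> a'.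
have nm1 : (n <= m.-1)%N by lia.
have c b := @orb_mul_cvg b a n ra (nonzero_beforeW nm1 nz) (nohit_uptoW nm1 nh).
near=> a' => b j; rewrite ltnS leq_eqVlt => /orP[/eqP ->|].
  have h : orb true a' n * (a' + 1) < 1.
    by near: a'; apply: (cvgr_lt _ (c true)); exact: st.
  have h' : orb false a' n * (a' + 1) < 1.
    by near: a'; apply: (cvgr_lt _ (c false)); exact: st.
  by case: b; apply: ltW.
by move: b j; near: a'; apply: IH; exact: ltnW.
Unshelve. all: by end_near. Qed.

Lemma matched_near b a m : regular a -> matched b a m ->
  \forall a' \near a, matched b a' m.
Proof.
move=> ra mm; have nz := matched_nonzero ra mm; have nh := matched_nohit ra mm.
have lb : \forall a' \near a, low_before a' m.
  apply: low_before_near => //.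
  - by apply: nonzero_beforeW nz; lia.
  - by apply: nohit_uptoW nh; lia.
  - by case: mm => lm _; exact: strict_of_nohit.
have c := @orb_mul_cvg b a m ra (nonzero_beforeW (leqnSn m) nz) nh.
near=> a'; split; first by near: a'.
by near: a'; apply: (cvgr_gt _ c); case: mm.
Unshelve. all: by end_near. Qed.

Lemma iter_inj a x i j : 0 < a < 1 -> generic x -> `|x| < 1 ->
  tanaka_ito_iter a i x = tanaka_ito_iter a j x -> i = j.
Proof.
move=> a01 gx x1; wlog ij : i j / (i <= j)%N.
  by move=> h; case/orP: (leq_total i j) => ij e; [|symmetry]; apply: h.
move=> e; apply/eqP; rewrite eqn_leq ij /= leqNgt; apply/negP => ij'.
have y1 : `|tanaka_ito_iter a i x| < 1.
  case: (i) => // k; have : a - 1 <= T a (tanaka_ito_iter a k x) < a.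
    by apply: tanaka_ito_ge_lt; lra.
  by rewrite -[T a _]/(tanaka_ito_iter a k.+1 x) ltr_norml; lra.
have d0 : (0 < j - i)%N by rewrite subn_gt0.
have := @generic_aperiodic _ _ _ _ 1 0 a01 (@generic_iter _ a x i gx) y1 d0 (oner_neq0 _).
apply.
by rewrite /tanaka_ito_iter -iterD subnK// mul1r addr0 -/(tanaka_ito_iter a j x) -e.
Qed.

(** Once the orbits have met they stay equal with the same time shift, and injectivity of the orbit
    of [a] forces every later meeting to have that shift. A strictly later pair would thus already
    agree one step earlier. *)
Lemma exponents_unique a M N M' N' : 0 < a < 1 -> generic a ->
  (0 < M)%N -> (0 < N)%N -> (0 < M')%N -> (0 < N')%N ->
  tanaka_ito_iter a M (a - 1) = tanaka_ito_iter a N a ->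
  tanaka_ito_iter a M.-1 (a - 1) <> tanaka_ito_iter a N.-1 a ->
  tanaka_ito_iter a M' (a - 1) = tanaka_ito_iter a N' a ->
  tanaka_ito_iter a M'.-1 (a - 1) <> tanaka_ito_iter a N'.-1 a ->
  M = M' /\ N = N'.
Proof.
move=> a01 ga; wlog MM : M N M' N' / (M <= M')%N.
  move=> h; case/orP: (leq_total M M') => ?; first exact: h.
  by move=> *; have [] := h M' N' M N.
move=> M0 N0 M0' N0' e n e' n'.
have an : `|a| < 1 by rewrite gtr0_norm; lra.
have shift k : tanaka_ito_iter a (k + M) (a - 1) = tanaka_ito_iter a (k + N) a.
  by rewrite /tanaka_ito_iter !iterD -/(tanaka_ito_iter a M _) e.
have NN : N' = (M' - M + N)%N.
  by apply: (iter_inj a01 ga an); rewrite -e' -shift subnK.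
have [MM0|MM0] := posnP (M' - M); first by split; lia.
case: n'; rewrite NN (_ : _.-1 = M' - M.+1 + M)%N; last by lia.
by rewrite shift; congr tanaka_ito_iter; lia.
Qed.

Lemma pre_matching_exponents M N J l r M' N' : (0 < M)%N -> (0 < N)%N ->
  @pre_matching_interval R M N J -> l < r -> (0 < M')%N -> (0 < N')%N ->
  (forall a, l < a < r -> [/\ J a,
     tanaka_ito_iter a M' (a - 1) = tanaka_ito_iter a N' a &
     tanaka_ito_iter a M'.-1 (a - 1) <> tanaka_ito_iter a N'.-1 a]) ->
  M = M' /\ N = N'.
Proof.
move=> M0 N0 [[_ J01] _ JM Jae] lr M0' N0' h.
have [a [la ar ga Na]] := generic_dense lr Jae.
have [Ja e1 e2] : [/\ J a, tanaka_ito_iter a M' (a - 1) = tanaka_ito_iter a N' a &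
     tanaka_ito_iter a M'.-1 (a - 1) <> tanaka_ito_iter a N'.-1 a].
  by apply: h; rewrite la.
have /= := J01 _ Ja; rewrite in_itv/= => /andP[a0 a1].
have a01 : 0 < a < 1.
  rewrite !lt_neqAle a0 a1 eq_sym (generic_neq0 ga) !andbT /=; apply/eqP => ae1.
  by have [|//] := @generic_affine _ a 1 (-1) ga; rewrite ae1; ring.
apply: (exponents_unique a01 ga) => //; first exact: JM.
by move=> Na'; apply: Na => /= H; exact: (H Ja).
Qed.

Lemma matched_pre_exponents M N J b a m : (0 < M)%N -> (0 < N)%N ->
  @pre_matching_interval R M N J -> J a -> regular a -> matched b a m ->
  (M, N) = exponents b m.
Proof.
move=> M0 N0 pJ Ja ra mm.
have [_ [oJ _] _ _] := pJ.
have near_a : \forall a' \near a, [/\ J a', regular a' & matched b a' m].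
  near=> a'; split; near: a'; last exact: matched_near.
    exact: open_nbhs_nbhs.
  exact: regular_near.
have /nbhs_ballP[e /= e0 ball_a] := near_a.
have h a' : a - e < a' < a + e ->
    [/\ J a', regular a' & matched b a' m].
  by move=> ?; apply: ball_a; rewrite /ball/= ltr_distlC.
have lr : a - e < a + e by lra.
case E : (exponents b m) => [M' N'].
have [M0' N0'] : (0 < M')%N /\ (0 < N')%N by move: E; case: (b) => -[<- <-].
have [|-> ->//] := pre_matching_exponents M0 N0 pJ lr M0' N0'.
move=> a' /h[Ja' ra' mm']; have := matched_exponents ra' mm'.
by rewrite E => -[].
Unshelve. all: by end_near. Qed.

Definition good a := forall m, low_before a m.

Lemma not_good_matched a : ~ good a -> exists b m, matched b a m.
Proof.
move=> ng; apply: contrapT => nm; apply: ng; elim=> [//|m IH] b j.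
rewrite ltnS leq_eqVlt => /orP[/eqP ->|jm]; last exact: IH.
rewrite /low leNgt; apply/negP => h; apply: nm.
by exists b, m.
Qed.

Lemma good_sumZ a n : regular a -> good a -> exists t c : nat,
  (n <= t)%N /\ forall b, orb b a t + orb (~~ b) a t = c%:R.
Proof.
move=> ra ga; suff [t [nt [e|e]]] : exists t, (n <= t)%N /\ sum01 (orb true a t) (orb false a t).
- by exists t, 0; split=> // -[]; rewrite // addrC.
- by exists t, 1; split=> // -[]; rewrite // addrC.
have [h|h] := orb_state true ra (ga n); first by exists n.
by exists n.+1; split=> //; exact: linked_step h.
Qed.

(** At some late time the two orbits have an integral sum $c$. If they met with different times on
    the two orbits, an iterate of some orbit point $y$ would be $c-y$; if with equal times, $2y=c$.
    Genericity excludes both. *)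
Lemma generic_not_good a M N : regular a -> generic a -> good a ->
  (0 < N)%N -> tanaka_ito_iter a M (a - 1) <> tanaka_ito_iter a N a.
Proof.
move=> ra gena ga; case: N => // N _; rewrite iter_right// => e.
have a01 : 0 < a < 1 by case: ra => *; lra.
have gorb b n : generic (orb b a n).
  apply: generic_iter; case: b; last exact: (@generic_subZ _ _ 1).
  apply: (@generic_invB _ a _ 1) => //.
  by rewrite subrK mulrC mulrA mulr1 divff//; exact: generic_neq0.
have shift k : orb false a (k + M) = orb true a (k + N).
  by rewrite /orb /tanaka_ito_iter !iterD; congr iter.
have [t [c [Mt ct]]] := good_sumZ (maxn M N) ra ga.
have aper b d : (0 < d)%N -> orb b a (d + t) <> - orb b a t + c%:R.
  move=> d0 h.
  have := @generic_aperiodic _ _ _ d (-1) c a01 (gorb b t) (orb_norm b t ra) d0 isT.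
  apply.
  by rewrite mulN1r -h /orb /tanaka_ito_iter -iterD.
have [MN|MN|MN] := ltngtP M N.
- apply: (aper true (N - M)%N); first by rewrite subn_gt0.
  have -> : (N - M + t = t - M + N)%N by lia.
  by rewrite -shift subnK -?(ct true) /=; [lra|lia].
- apply: (aper false (M - N)%N); first by rewrite subn_gt0.
  have -> : (M - N + t = t - N + M)%N by lia.
  by rewrite shift subnK -?(ct true) /=; [lra|lia].
- have e2 : orb false a t = orb true a t.
    by have := shift (t - M)%N; rewrite (_ : t - M + N = t)%N ?subnK//; lia.
  have [] := @generic_affine _ _ 2 (- c%:Z) (gorb true t) => //.
  by rewrite intrN /= -[c%:~R]/(c%:R) -(ct true) /= e2; ring.
Qed.

Lemma generic_matched M N J a : (0 < M)%N -> (0 < N)%N ->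
  @pre_matching_interval R M N J -> J a -> regular a -> generic a ->
  exists b m, matched b a m /\ (M, N) = exponents b m.
Proof.
move=> M0 N0 pJ Ja ra ga.
have [_ _ JM _] := pJ.
have /not_good_matched[b [m mm]] : ~ good a.
  by move=> gg; exact: (generic_not_good (M := M) ra ga gg N0 (JM _ Ja)).
by exists b, m; split=> //; exact: (matched_pre_exponents M0 N0 pJ Ja ra mm).
Qed.

End Matching.

(** * Two merging behaviours on the two sides of a hit *)

Section Bifurcation.
Context {R : realType}.
Implicit Types (a x y : R) (U : set R).
Local Notation T := tanaka_ito.

(* A matching time [m] occurs in [U], and [U] contains a generic parameter whose
   matching time, if any, is larger than [m]. *)
Definition separated U := exists m,
  (exists b a', [/\ U a', regular a' & matched b a' m]) /\
  (exists a', [/\ U a', regular a', generic a' & low_before a' m.+1]).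

Lemma near_segment (P : R -> Prop) a : (\forall a' \near a, P a') ->
  exists2 e : R, 0 < e & forall a', a - e < a' < a + e -> P a'.
Proof.
move/nbhs_ballP => [e /= e0 h]; exists e => // a' aa; apply: h.
by rewrite /ball/= ltr_distlC.
Qed.

(** The branch through $a-1$ has difference quotients strictly above 1 in absolute value, while
    those of $a'-1$ equal 1, so it crosses $a'-1$ transversally; [h] orients the parameter so that
    the branch lies above for positive [h]. *)
Lemma hit_crossing b a k (m : int) : regular a -> nonzero_before a k.+1 ->
  nohit_upto a k -> (orb b a k)^-1 - m%:~R = a - 1 ->
  let h a' := (-1) ^+ (k + b).+1 * (a' - a) in
  \forall a' \near a,
    (0 < h a' -> a' - 1 < (orb b a' k)^-1 - m%:~R) /\
    (h a' < 0 -> (orb b a' k)^-1 - m%:~R < a' - 1).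
Proof.
move=> ra nz nh e h.
have [fc fe] := orb_local b ra (nonzero_beforeW (leqnSn k) nz) nh.
have f0 : orb b a k != 0 by exact: nz.
have H := expanding_inv m%:~R fc f0 (orb_norm b k ra) fe.
near=> a'; have [aa|aa] := eqVneq a' a.
  by rewrite /h aa subrr mulr0 ltxx.
have : (a' - a) ^+ 2 < - (-1) ^+ (k + b) *
    ((orb b a' k)^-1 - m%:~R - ((orb b a k)^-1 - m%:~R)) * (a' - a).
  by move: aa; near: a'.
rewrite e /h [(-1) ^+ _.+1]exprS mulN1r.
set E := (orb b a' k)^-1 - m%:~R.
by rewrite -signr_odd; case: odd; rewrite ?(expr0, expr1) => hh; split=> h'; nra.
Unshelve. all: by end_near. Qed.

(** On one side of [a] the value at time [k.+1] stays near $a-1$ and both orbits remain low; on the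
    other the orbits merge. Generic points exist on the low side. *)
Lemma hit_separated b a k U : regular a -> nonzero_before a k.+1 ->
  nohit_upto a k -> low_before a k.+1 -> orb b a k.+1 = a - 1 ->
  (\forall a' \near a, U a') -> separated U.
Proof.
move=> ra nz nh lo hit nU; have [ha a1 ga] := ra.
have nzk := nonzero_beforeW (leqnSn k) nz.
have f0 : orb b a k != 0 by exact: nz.
have [fc _] := orb_local b ra nzk nh.
have [m [em _]] := tanaka_ito_spec a f0.
have fV : (orb b a k)^-1 - m%:~R = a - 1.
  by rewrite -hit orbS; apply: (mulIf f0); rewrite mulrBl mulVf//; lra.
have nC := hit_crossing ra nz nh fV.
have nT := T_near_hit ra fc em hit.
have Ec : (fun a' => (orb b a' k)^-1 - m%:~R) @ a --> a - 1.
  by rewrite -fV; apply: cvgB; [exact: cvgV|exact: cvg_cst].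
have partner : a - 1 < orb (~~ b) a k.+1 /\ orb (~~ b) a k.+1 * (a + 1) < 1.
  have [->|->] := hit_partner ra lo hit; first by split; nra.
  have h0 : 0 < 1 / a - 1 by rewrite subr_gt0 ltr_pdivlMr; lra.
  split; first by lra.
  have -> : (1 / a - 1) * (a + 1) = (1 - a * a) / a by field; rewrite gt_eqF//; lra.
  by rewrite ltr_pdivrMr; lra.
have /low_strict hnb : orb (~~ b) a k.+1 != a - 1 by rewrite gt_eqF//; case: partner.
have {}hnb : orb (~~ b) a k * (a + 1) < 1 by apply: hnb => //; exact: lo.
have stk : strict_before a k.
  by apply: strict_of_nohit => //; exact: low_beforeW lo.
have bb b' : b' = b \/ b' = ~~ b by case: (b) (b') => -[]; auto.
suff [n nn] : exists n, \forall a' \near a,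
    [/\ U a', regular a', (-1) ^+ (k + b).+1 * (a' - a) < 0 -> matched b a' n &
        0 < (-1) ^+ (k + b).+1 * (a' - a) -> low_before a' n.+1].
  have [e e0 he] := near_segment nn.
  pose s : R := (-1) ^+ (k + b).+1.
  have s1 : s = 1 \/ s = -1.
    by rewrite /s -signr_odd; case: odd; rewrite ?(expr0, expr1); [right|left].
  have [l [r [lr rl]]] : exists l r : R, l < r /\ forall x, l < x < r ->
      a - e < x < a + e /\ 0 < s * (x - a).
    case: s1 => ->; first by exists a, (a + e); split=> [|x /andP[? ?]]; [lra|split; lra].
    by exists (a - e), a; split=> [|x /andP[? ?]]; [lra|split; lra].
  exists n; split.
    have hx : a - e < a - s * (e / 2) < a + e by case: s1 => ->; lra.
    have [Ux rx mx _] := he _ hx.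
    exists b, (a - s * (e / 2)); split=> //; apply: mx.
    by rewrite -/s; case: s1 => ->; lra.
  have [x [lx xr gx _]] := generic_dense lr (@negligible_set0 _ _ _ (@lebesgue_measure R)).
  have [|xe sx] := rl x; first by rewrite lx.
  by have [Ux rx _ lox] := he x xe; exists x; split=> //; exact: lox.
have lowk : \forall a' \near a, low_before a' k.
  apply: low_before_near => //; first by apply: nonzero_beforeW nz; lia.
  by apply: nohit_uptoW nh; lia.
have cm := @orb_mul_cvg _ b a k ra nzk nh.
have cm' := @orb_mul_cvg _ (~~ b) a k ra nzk nh.
(* If the value before the hit is exactly $1/(a+1)$, the digit is 2, and falling below $a'-1$ at
   time [k.+1] means exceeding $1/(a'+1)$ at time [k]: the merging time is [k]. *)
have [h1|h1] := eqVneq (orb b a k * (a + 1)) 1.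
  exists k.
  have fp : 0 < orb b a k by rewrite -(pmulr_lgt0 _ (_ : 0 < a + 1)) ?h1//; lra.
  have m2 : m%:~R = 2 :> R.
    have : (orb b a k)^-1 = a + 1 by apply: (mulfI f0); rewrite mulfV// h1.
    by lra.
  near=> a'.
  have f0' : 0 < orb b a' k by near: a'; exact: (cvgr_gt _ fc).
  have [cr1 cr2] : (0 < (-1) ^+ (k + b).+1 * (a' - a) -> a' - 1 < (orb b a' k)^-1 - m%:~R) /\
    ((-1) ^+ (k + b).+1 * (a' - a) < 0 -> (orb b a' k)^-1 - m%:~R < a' - 1).
    by near: a'.
  have fi : (orb b a' k)^-1 * orb b a' k = 1 by rewrite mulVf ?gt_eqF.
  split; [by near: a'|by near: a'; exact: regular_near| |].
    move=> /cr2; rewrite m2 => cr; split; first by near: a'.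
    by nra.
  move=> /cr1; rewrite m2 => cr b' j; rewrite ltnS leq_eqVlt => /orP[/eqP ->|].
    have [->|->] := bb b'; first by rewrite /low; nra.
    by apply: ltW; near: a'; exact: (cvgr_lt _ cm').
  by move: b' j; near: a'.
(* Otherwise time [k] is strictly low near [a], and the wrapped value at time [k.+1], close to [a],
   is the first to exceed the bound. *)
exists k.+1.
have st1 : strict_before a k.+1.
  move=> b' j; rewrite ltnS leq_eqVlt => /orP[/eqP ->|]; last exact: stk.
  have [->|->//] := bb b'.
  by rewrite lt_neqAle h1 /=; exact: lo.
have lowk1 : \forall a' \near a, low_before a' k.+1 by exact: low_before_near.
have add1 : (fun a' : R => a' + 1) @ a --> a + 1.
  by apply: cvgD; [exact: cvg_id|exact: cvg_cst].
have [cn _] : (fun a' => T a' (orb (~~ b) a' k)) @ a --> T a (orb (~~ b) a k) /\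
  exists m : int, T a (orb (~~ b) a k) = (orb (~~ b) a k)^-1 - m%:~R /\
    \forall a' \near a, T a' (orb (~~ b) a' k) = (orb (~~ b) a' k)^-1 - m%:~R.
  apply: T_cvg; [by have [] := orb_local (~~ b) ra nzk nh|exact: nz|].
  rewrite -orbS; case: partner => -> _.
  by have /andP[] := orb_range (~~ b) k.+1 ra.
have cE : (fun a' => ((orb b a' k)^-1 - m%:~R) * (a' + 1)) @ a --> (a - 1) * (a + 1).
  exact: cvgM.
have cE1 : (fun a' => ((orb b a' k)^-1 - m%:~R + 1) * (a' + 1)) @ a --> (a - 1 + 1) * (a + 1).
  by apply: cvgM => //; apply: cvgD => //; exact: cvg_cst.
have cn1 : (fun a' => T a' (orb (~~ b) a' k) * (a' + 1)) @ a -->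
    T a (orb (~~ b) a k) * (a + 1) by exact: cvgM.
near=> a'.
have [cr1 cr2] : (0 < (-1) ^+ (k + b).+1 * (a' - a) -> a' - 1 < (orb b a' k)^-1 - m%:~R) /\
  ((-1) ^+ (k + b).+1 * (a' - a) < 0 -> (orb b a' k)^-1 - m%:~R < a' - 1).
  by near: a'.
have Te : T a' (orb b a' k) =
    if a' - 1 <= (orb b a' k)^-1 - m%:~R then (orb b a' k)^-1 - m%:~R
    else (orb b a' k)^-1 - m%:~R + 1 by near: a'.
split; [by near: a'|by near: a'; exact: regular_near| |].
  move=> /cr2 cr; split; first by near: a'.
  rewrite orbS Te leNgt cr /=; near: a'; apply: (cvgr_gt _ cE1); nra.
move=> /cr1 cr b' j; rewrite ltnS leq_eqVlt => /orP[/eqP ->|]; last by move: b' j; near: a'.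
have [->|->] := bb b'; apply: ltW.
  rewrite orbS Te (ltW cr); near: a'; apply: (cvgr_lt _ cE); nra.
by rewrite orbS; near: a'; apply: (cvgr_lt _ cn1); case: partner.
Unshelve. all: by end_near. Qed.

End Bifurcation.

(** * Good parameters lie in no matching interval *)

Section Inner.
Context {R : realType}.
Implicit Types (a x y : R) (U : set R).
Local Notation T := tanaka_ito.

Lemma orb0_neq0 b a : regular a -> orb b a 0 != 0.
Proof.
case=> ha a1 ga; rewrite /orb /tanaka_ito_iter /=; case: b; last by rewrite lt_eqF; lra.
by rewrite gt_eqF// subr_gt0 ltr_pdivlMr; lra.
Qed.

Lemma first_singular a n : regular a ->
  (nonzero_before a n.+1 /\ nohit_upto a n) \/
  (exists k b, [/\ nonzero_before a k.+1, nohit_upto a k & orb b a k.+1 = a - 1]) \/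
  (exists k b, [/\ nonzero_before a k.+1, nohit_upto a k.+1 & orb b a k.+1 = 0]).
Proof.
move=> ra; elim: n => [|n [[nz nh]|]]; last by right.
  left; split=> [b [|//] _|b []//]; exact: orb0_neq0.
have [[b hb]|noh] := pselect (exists b, orb b a n.+1 = a - 1).
  by right; left; exists n, b.
have nh' : nohit_upto a n.+1.
  move=> b j /andP[j0]; rewrite leq_eqVlt => /orP[/eqP ->|jn].
    by apply/eqP => hb; apply: noh; exists b.
  by apply: nh; rewrite j0.
have [[b hb]|noz] := pselect (exists b, orb b a n.+1 = 0).
  by right; right; exists n, b.
left; split=> // b j; rewrite ltnS leq_eqVlt => /orP[/eqP ->|]; last exact: nz.
by apply/eqP => hb; apply: noz; exists b.
Qed.

Lemma nonsingular_near a n : regular a -> nonzero_before a n -> nohit_upto a n ->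
  \forall a' \near a, nonzero_before a' n /\ nohit_upto a' n.
Proof.
move=> ra; elim: n => [|n IH] nz nh.
  by near=> a'; split=> // b [].
have cn b := orb_local b ra (nonzero_beforeW (leqnSn n) nz) (nohit_uptoW (leqnSn n) nh).
have cn1 b := orb_local b ra nz nh.
have {}IH := IH (nonzero_beforeW (leqnSn n) nz) (nohit_uptoW (leqnSn n) nh).
have nz1 b : \forall a' \near a, orb b a' n != 0.
  by have [c _] := cn b; apply: (cvgr_neq0 _ c); exact: nz.
have nh1 b : \forall a' \near a, orb b a' n.+1 - (a' - 1) != 0.
  have [c _] := cn1 b.
  have c' : (fun a' => orb b a' n.+1 - (a' - 1)) @ a --> orb b a n.+1 - (a - 1).
    by apply: cvgB => //; apply: cvgB; [exact: cvg_id|exact: cvg_cst].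
  by apply: (cvgr_neq0 _ c'); rewrite subr_eq0; apply: nh; rewrite leqnn.
near=> a'.
have [IH1 IH2] : nonzero_before a' n /\ nohit_upto a' n by near: a'.
have zt : orb true a' n != 0 by near: a'; exact: nz1.
have zf : orb false a' n != 0 by near: a'; exact: nz1.
have ht : orb true a' n.+1 - (a' - 1) != 0 by near: a'; exact: nh1.
have hf : orb false a' n.+1 - (a' - 1) != 0 by near: a'; exact: nh1.
split=> b j.
  by rewrite ltnS leq_eqVlt => /orP[/eqP ->|]; [case: b|exact: IH1].
move=> /andP[j0]; rewrite leq_eqVlt => /orP[/eqP ->|jn].
  by rewrite -subr_eq0; case: b.
by apply: IH2; rewrite j0.
Unshelve. all: by end_near. Qed.

Lemma IVT_int (f : R -> R) (p q : R) : p <= q -> {within `[p, q], continuous f} ->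
  1 <= `|f p - f q| -> exists c, exists m : int, p <= c <= q /\ f c = m%:~R.
Proof.
move=> pq fc pq1.
have [m mpq] : exists m : int, Num.min (f p) (f q) <= m%:~R <= Num.max (f p) (f q).
  move: pq1; wlog pq' : p q {pq fc} / f p <= f q.
    move=> h; case/orP: (le_total (f p) (f q)) => [?|?]; first exact: h.
    by rewrite distrC minC maxC; exact: h.
  rewrite ler0_norm ?subr_le0// opprB => h; exists (Num.floor (f q)).
  have /andP[h1 h2] := floor_itv (f q); rewrite intrD in h2.
  by rewrite min_l// max_r// h1 andbT; lra.
have [c /[!in_itv] /= cpq fcm] := IVT pq fc mpq.
by exists c, m.
Qed.

(** Next to a zero the reciprocal is unbounded, so it passes through infinitely many branches; some
    nearby parameter hits its own lower end point one step later. *)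
Lemma zero_separated b a k U : regular a -> open U -> U a -> nonzero_before a k.+1 ->
  nohit_upto a k.+1 -> low_before a k.+1 -> orb b a k.+1 = 0 -> separated U.
Proof.
move=> ra oU Ua nz nh lo zb.
have z b' : orb b' a k.+1 = 0 := zero_both b' ra lo zb.
have [c fe] := orb_local false ra nz nh.
have st : strict_before a k.+2.
  move=> b' j; rewrite ltnS leq_eqVlt => /orP[/eqP ->|].
    by rewrite z mul0r.
  exact: strict_of_nohit.
have nl : \forall a' \near a, low_before a' k.+2 by exact: low_before_near.
have [e e0 he] : exists2 e, 0 < e & forall a', a - e < a' < a + e ->
    [/\ U a', regular a', low_before a' k.+2, nonzero_before a' k.+1 /\ nohit_upto a' k.+1 &
      (a' - a) ^+ 2 <= (-1) ^+ (k.+1 + false) * (orb false a' k.+1 - orb false a k.+1) * (a' - a)].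
  apply: near_segment; near=> a'; split; near: a' => //.
  - exact: open_nbhs_nbhs.
  - exact: regular_near.
  - exact: nonsingular_near.
pose f a' := orb false a' k.+1.
have f0 a' : a < a' < a + e -> f a' != 0.
  move=> aa'; have [|_ _ _ _] := he a'; first by lra.
  rewrite z subr0 -/(f a') => h; apply/eqP => f0; move: h.
  by rewrite f0 mulr0 mul0r leNgt exprn_even_gt0//= subr_eq0 gt_eqF//; lra.
(* [F] is an integer exactly where the next point of the orbit is $a'-1$. *)
pose F a' := (f a')^-1 + 1 - a'.
have Fc a' : a < a' < a + e -> F @ a' --> F a'.
  move=> aa'; have [|_ ra' _ [nz' nh'] _] := he a'; first by lra.
  have [fc _] := orb_local false ra' nz' nh'.
  apply: cvgB; last exact: cvg_id.
  by apply: cvgD; [apply: cvgV => //; exact: f0|exact: cvg_cst].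
pose q := a + e / 2.
have [p [ap pq pF]] : exists p, [/\ a < p, p < q & 1 <= `|F p - F q| ].
  (* If $1/f(p)$ exceeds this in absolute value, removing $|p-1| \le |a|+1$ and $|F(q)|$ leaves a
     variation of [F] above 3. *)
  pose B := `|F q| + 4 + `|a|.
  have B0 : 0 < B by rewrite /B; have := normr_ge0 (F q); have := normr_ge0 a; lra.
  have ns : \forall a' \near a, `|f a'| < B^-1.
    have c0 : f @ a --> (0 : R) by rewrite -(z false); exact: c.
    by apply: (cvgr0_norm_lt _ c0); rewrite invr_gt0.
  have [e' e'0 he'] := near_segment ns.
  pose d := Num.min (e / 4) (Num.min (e' / 2) 1).
  have [d1 d2 d3] : [/\ d <= e / 4, d <= e' / 2 & d <= 1].
    by rewrite /d !ge_min !lexx !orbT.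
  have d0 : 0 < d by rewrite /d !lt_min ltr01 !andbT; apply/andP; split; lra.
  exists (a + d); split; [lra|by rewrite /q; lra|].
  have fp : f (a + d) != 0 by apply: f0; lra.
  have fB : B < `|(f (a + d))^-1|.
    rewrite normfV -[B]invrK ltf_pV2 ?posrE ?invr_gt0 ?normr_gt0//.
    by apply: he'; lra.
  have := ler_normB (F (a + d)) (F q).
  have : `|(f (a + d))^-1| <= `|F (a + d)| + `|(a + d - 1)|.
    have {1}-> : (f (a + d))^-1 = F (a + d) + (a + d - 1) by rewrite /F; ring.
    exact: ler_normD.
  have : `|F (a + d)| <= `|F (a + d) - F q| + `|F q|.
    by rewrite -{1}[F (a + d)](subrK (F q)); exact: ler_normD.
  have : `|a + d - 1| <= `|a| + `|d - 1| by rewrite -addrA; exact: ler_normD.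
  have : `|d - 1| <= 1 by rewrite ler_norml; lra.
  by move: fB; rewrite /B; lra.
have [|c' [m [/andP[pc cq] Fcm]]] := IVT_int (ltW pq) _ pF.
  apply: continuous_in_subspaceT => x; rewrite inE /= in_itv /= => /andP[px xq].
  by apply: Fc; rewrite /q in xq; lra.
have ac : a < c' < a + e by rewrite /q in cq; lra.
have [|Uc rc lc [nzc nhc] _] := he c'; first by lra.
have hit : orb false c' k.+2 = c' - 1.
  rewrite orbS; apply: (@tanaka_ito_char _ _ _ _ m); last by lra.
  rewrite -Fcm /F -/(f c') (_ : c' - 1 + _ = (f c')^-1); last by ring.
  by rewrite mulVf// f0.
apply: (hit_separated rc _ nhc lc hit); last by apply: open_nbhs_nbhs.
move=> b' j; rewrite ltnS leq_eqVlt => /orP[/eqP ->|]; last exact: nzc.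
apply/eqP => h0; have := zero_both false rc (low_beforeW (leqnSn _) lc) h0.
by move=> h1; have := f0 c' ac; rewrite /f h1 eqxx.
Unshelve. all: by end_near. Qed.

Lemma good_separated a K U : regular a -> open U -> U a -> good a ->
  separated U \/ exists a', [/\ U a', regular a', generic a' & low_before a' K].
Proof.
move=> ra oU Ua ga.
have [[nz nh]|[[k [b [nz nh h]]]|[k [b [nz nh h]]]]] := first_singular K ra.
- right; have nl : \forall a' \near a, low_before a' K.
    apply: low_before_near => //; last exact: strict_of_nohit.
    - by apply: nonzero_beforeW nz; lia.
    - by apply: nohit_uptoW nh; lia.
  have [e e0 he] : exists2 e, 0 < e & forall a', a - e < a' < a + e ->
      [/\ U a', regular a' & low_before a' K].
    apply: near_segment; near=> a'; split; near: a' => //.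
      exact: open_nbhs_nbhs.
    exact: regular_near.
  have lr : a - e < a + e by lra.
  have [x [lx xr gx _]] := generic_dense lr (@negligible_set0 _ _ _ (@lebesgue_measure R)).
  have [|Ux rx lox] := he x; first by rewrite lx.
  by exists x.
- left; apply: (hit_separated ra nz nh (ga _) h).
  exact: open_nbhs_nbhs.
- by left; apply: (zero_separated ra oU Ua nz nh (ga _) h).
Unshelve. all: by end_near. Qed.

Lemma exponents_inj b b' m m' : exponents b m = exponents b' m' -> m = m'.
Proof. by case: b; case: b' => -[]; lia. Qed.

Lemma matched_ge b a m n : matched b a m -> low_before a n -> (n <= m)%N.
Proof.
case=> lm hm lo; rewrite leqNgt; apply/negP => mn.
by have := lo b m mn; rewrite /low leNgt hm.
Qed.

(** A separated interval would have two merging times, hence two pairs of exponents. Otherwise some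
    generic point of it merges at time [M] or later, although both forms of [exponents] make [M]
    exceed the merging time. *)
Lemma good_not_pre_matching M N J a : (0 < M)%N -> (0 < N)%N ->
  @pre_matching_interval R M N J -> J a -> regular a -> ~ good a.
Proof.
move=> M0 N0 pJ Ja ra ga.
have [_ [oJ _] _ _] := pJ.
have [[m [[b [x [Jx rx mx]]] [y [Jy ry gy ly]]]]|[x [Jx rx gx lx]]] :=
    good_separated M ra oJ Ja ga.
  have e := matched_pre_exponents M0 N0 pJ Jx rx mx.
  have [b' [m' [my e']]] := generic_matched M0 N0 pJ Jy ry gy.
  have mm := matched_ge my ly.
  by move: mm; rewrite -(exponents_inj (etrans (esym e) e')) ltnn.
have [b' [m' [mx e]]] := generic_matched M0 N0 pJ Jx rx gx.
have := matched_ge mx lx.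
by move: e; case: (b') => -[-> _]; rewrite leqNgt ?ltnS ?leqnn ?leqnSn.
Qed.

End Inner.

(** * Maximal matching intervals and the end points g and 1 *)

Section MatchingSet.
Context {R : realType}.
Implicit Types (a x y : R) (J K : set R).
Local Notation T := tanaka_ito.

(* The exceptional null sets of uncountably many intervals are handled through
   intervals with rational end points. *)
Lemma pre_matching_bigcup M N J0 a : @pre_matching_interval R M N J0 -> J0 a ->
  pre_matching_interval M N (\bigcup_(K in [set K | pre_matching_interval M N K /\ K a]) K).
Proof.
move=> pJ0 J0a; split.
- split; first by exists a, J0.
  by move=> x [K [[[_ K01] _ _ _] _]] Kx; exact: K01.
- split; first by apply: bigcup_open => K [[_ [oK _] _ _] _].
  move=> x y [K [pK Ka] Kx] [L [pL La] Ly] z xzy.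
  case/orP: (le_total z a) => za.
    exists K => //; have [_ [_ iK] _ _] := pK; apply: (iK x a Kx Ka).
    by rewrite za andbT; case/andP: xzy.
  exists L => //; have [_ [_ iL] _ _] := pL; apply: (iL a y La Ly).
  by rewrite za; case/andP: xzy.
- by move=> x [K [[_ _ KM _] _]] Kx; exact: KM.
pose bad := [set x : R | tanaka_ito_iter x M.-1 (x - 1) = tanaka_ito_iter x N.-1 x].
(* Each [G pq] is null: one interval [K] containing both rational points contains all that lies
   between them. *)
pose G (pq : rat * rat) : set R := [set x | [/\ ratr pq.1 < x < ratr pq.2, bad x &
  exists K, [/\ pre_matching_interval M N K, K (ratr pq.1) & K (ratr pq.2)]]].
have Gneg pq : (@lebesgue_measure R).-negligible (G pq).
  have [[K [pK Kp Kq]]|nK] := pselect (exists K,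
      [/\ pre_matching_interval M N K, K (ratr pq.1) & K (ratr pq.2)]).
    have [_ [_ iK] _ Kae] := pK.
    apply: negligibleS Kae => x [/andP[px xq] bx _] /= /(_ _); apply=> //.
    by apply: (iK _ _ Kp Kq); rewrite !ltW.
  by apply: negligibleS (negligible_set0 _) => x [_ _ /nK].
pose G' n : set R := if unpickle n is Some pq then G pq else set0.
have G'neg n : (@lebesgue_measure R).-negligible (G' n).
  by rewrite /G'; case: unpickle => [pq|]; [exact: Gneg|exact: negligible_set0].
apply: negligibleS (negligible_bigcup G'neg) => x /= /not_implyP[[K [pK Ka] Kx]] /contrapT bx.
have [_ [oK iK] _ _] := pK.
have ratK y : K y -> exists p q : rat, [/\ K (ratr p), K (ratr q) & ratr p < y < ratr q].
  move=> Ky; have [e e0 he] := near_segment (open_nbhs_nbhs (conj oK Ky)).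
  have [|p /[!in_itv]/= /andP[p1 p2]] := @rat_in_itvoo R (y - e) y; first by lra.
  have [|q /[!in_itv]/= /andP[q1 q2]] := @rat_in_itvoo R y (y + e); first by lra.
  by exists p, q; split; [apply: he; lra|apply: he; lra|lra].
have [p [q [Kp Kq pxq]]] := ratK x Kx.
have [n En] : exists n, unpickle n = Some (p, q).
  by exists (pickle (p, q)); exact: pickleK.
exists n; first exact: I.
rewrite /G' En; split; [exact: pxq|exact: bx|by exists K].
Qed.

(** The exponents persist near [a]; the union of all intervals through [a] with these exponents
    supplies maximality. *)
Lemma matched_in_matching_set b a m : regular a -> matched b a m -> matching_set R a.
Proof.
move=> ra mm; case E : (exponents b m) => [M N].
have [M0 N0] : (0 < M)%N /\ (0 < N)%N by move: E; case: (b) => -[<- <-].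
have [e e0 he] : exists2 e, 0 < e & forall a', a - e < a' < a + e ->
    regular a' /\ matched b a' m.
  apply: near_segment; near=> a'; split; near: a'; first exact: regular_near.
  exact: matched_near.
have pJ : pre_matching_interval M N [set x | a - e < x < a + e].
  have rel x : a - e < x < a + e -> tanaka_ito_iter x M (x - 1) = tanaka_ito_iter x N x /\
      tanaka_ito_iter x M.-1 (x - 1) <> tanaka_ito_iter x N.-1 x.
    by move=> /he[rx mx]; have := matched_exponents rx mx; rewrite E.
  split.
  - split; first by exists a => /=; lra.
    move=> x /= /he[[h1 h2 _] _]; rewrite in_itv/=; lra.
  - split.
      rewrite (_ : [set x | _] = `]a - e, a + e[%classic); first exact: interval_open.
      by apply/seteqP; split=> x /=; rewrite in_itv.
    by move=> x y /= ? ? z ?; lra.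
  - by move=> x /rel[].
  - by apply: aeW => x /rel[].
have aJ : [set x | a - e < x < a + e] a by rewrite /=; lra.
have pU := pre_matching_bigcup pJ aJ.
exists M, N, (\bigcup_(K in [set K | pre_matching_interval M N K /\ K a]) K).
split=> //; last by exists [set x | a - e < x < a + e].
split; first exact: pU.
move=> K pK UK; apply/seteqP; split=> // x Kx.
exists K => //; split=> //; apply: UK.
by exists [set x | a - e < x < a + e].
Unshelve. all: by end_near. Qed.

Lemma golden_eq : golden R * golden R + golden R = 1.
Proof.
have h : Num.sqrt 5 ^+ 2 = 5 :> R by rewrite sqr_sqrtr// ler0n.
by rewrite /golden; lra.
Qed.

Lemma golden_bounds : 61 / 100 < golden R < 62 / 100.
Proof.
have h := golden_eq.
have g0 : 0 < golden R.
  rewrite /golden divr_gt0// subr_gt0 -[ltLHS]sqrtr1 ltr_sqrt ?ltr0n//.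
  by rewrite ltr1n.
by apply/andP; split; nra.
Qed.

Lemma regular_golden a : golden R < a < 1 -> regular a.
Proof.
have := golden_eq; have := golden_bounds => gb ge ag.
by split; nra.
Qed.

(** The lower bound lies between 3/5 and g: the second iterates have numerator $5a-3$ and would
    coincide at $a = 3/5$. Their reciprocals differ by 1. *)
Lemma golden_left a : 61 / 100 < a < golden R ->
  tanaka_ito_iter a 3 (a - 1) = tanaka_ito_iter a 3 a /\
  tanaka_ito_iter a 2 (a - 1) <> tanaka_ito_iter a 2 a.
Proof.
have ge := golden_eq; have gb := golden_bounds => /andP[a1 ag].
have h : a * a + a < 1 by nra.
have n1 : 0 < a by lra.
have n2 : 0 < 1 - a by lra.
have n3 : 0 < 2 - 3 * a by lra.
have n4 : 0 < 2 * a - 1 by lra.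
have n5 : 0 < 5 * a - 3 by lra.
have p1 : T a (a - 1) = (2 - 3 * a) / (1 - a).
  apply: (@tanaka_ito_char _ _ _ _ (-3)); first by field; lra.
  by rewrite ltr_pdivrMr// ler_pdivlMr//; nra.
have q1 : T a a = (1 - 2 * a) / a.
  apply: (@tanaka_ito_char _ _ _ _ 2); first by field; lra.
  by rewrite ltr_pdivrMr// ler_pdivlMr//; nra.
have p2 : T a (T a (a - 1)) = (5 * a - 3) / (2 - 3 * a).
  rewrite p1; apply: (@tanaka_ito_char _ _ _ _ 2); first by field; lra.
  by rewrite ltr_pdivrMr// ler_pdivlMr//; nra.
have q2 : T a (T a a) = (5 * a - 3) / (2 * a - 1).
  rewrite q1; apply: (@tanaka_ito_char _ _ _ _ (-3)); first by field; lra.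
  by rewrite ltr_pdivrMr// ler_pdivlMr//; nra.
rewrite /tanaka_ito_iter /= p2 q2; split.
  apply: (@tanaka_ito_modZ _ _ _ _ (-1)); rewrite ?mulf_neq0 ?invr_eq0 ?gt_eqF//.
  by field; lra.
move/(congr1 (fun t => t * (2 - 3 * a) * (2 * a - 1) / (5 * a - 3))).
have -> : (5 * a - 3) / (2 - 3 * a) * (2 - 3 * a) * (2 * a - 1) / (5 * a - 3) = 2 * a - 1.
  by field; lra.
have -> : (5 * a - 3) / (2 * a - 1) * (2 - 3 * a) * (2 * a - 1) / (5 * a - 3) = 2 - 3 * a.
  by field; lra.
by lra.
Qed.

Lemma orb0_low b a : regular a -> low a (orb b a 0).
Proof.
move=> ra; have l0 := orb_linked0 ra; apply: ltW.
case: b; last exact: linked_lt l0.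
case: l0 => e h1 h2; apply: (@linked_lt _ _ _ (orb false a 0)) => //.
by split=> //; lra.
Qed.

(** For $a < 2/3$ the point [orb true a 1] is negative; in each possible state its partner is then
    low, since a sum of 1 would push the partner above 1. *)
Lemma golden_right a : golden R < a < 65 / 100 -> low_before a 2.
Proof.
have ge := golden_eq; have gb := golden_bounds => ag.
have ra : regular a by apply: regular_golden; lra.
have [ha a1 ga] := ra.
have lb1 : low_before a 1 by move=> b [|//] _; exact: orb0_low.
have u1 : orb true a 1 = a / (1 - a) - 2.
  rewrite orbS /orb /tanaka_ito_iter /=.
  apply: (@tanaka_ito_char _ _ _ _ 2); first by field; lra.
  have h1 : a + 1 <= a / (1 - a) by rewrite ler_pdivlMr; nra.
  have h2 : a / (1 - a) < a + 2 by rewrite ltr_pdivrMr; nra.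
  by lra.
have un : orb true a 1 < 0.
  by rewrite u1 subr_lt0 ltr_pdivrMr; lra.
have /andP[ul _] := orb_range true 1 ra.
have /andP[_ xl] := orb_range false 1 ra.
have st := orb_state false ra lb1.
move=> b [_|[|//] _]; first exact: orb0_low.
case: b; first by rewrite /low (le_trans _ ler01)// pmulr_lle0 ?ltW//; lra.
case: st => [[e|e]|l].
- by apply/ltW/(sum0_lt ra ul e).
- have {}e : orb false a 1 + orb true a 1 = 1 by exact: e.
  by rewrite /low; lra.
- by apply/ltW/(linked_lt ra l).
Qed.

(** The left side of g forces (3, 3). On the right the merging time is at least 2, and then neither
    (m+1, m+3) nor (m+2, m+2) is (3, 3). *)
Lemma golden_not_pre_matching M N J : (0 < M)%N -> (0 < N)%N ->
  pre_matching_interval M N J -> ~ J (golden R).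
Proof.
move=> M0 N0 pJ Jg; have [_ [oJ _] _ _] := pJ.
have [e e0 he] := near_segment (open_nbhs_nbhs (conj oJ Jg)).
have gb := golden_bounds.
pose l := Num.max (golden R - e) (61 / 100).
have [l1 l2] : golden R - e <= l /\ 61 / 100 <= l by rewrite /l !le_max !lexx orbT.
have lg : l < golden R by rewrite /l gt_max; lra.
have [|M3 N3] := pre_matching_exponents (M' := 3) (N' := 3) M0 N0 pJ lg isT isT.
  move=> a la; have [|e1 e2] := @golden_left a; first by lra.
  by split=> //; apply: he; lra.
pose r := Num.min (golden R + e) (65 / 100).
have [r1 r2] : r <= golden R + e /\ r <= 65 / 100 by rewrite /r !ge_min !lexx orbT.
have gr : golden R < r by rewrite /r lt_min; lra.
have [a [ga ar gena _]] := generic_dense gr (@negligible_set0 _ _ _ (@lebesgue_measure R)).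
have ra : regular a by apply: regular_golden; lra.
have Ja : J a by apply: he; lra.
have [b [m [mm]]] := generic_matched M0 N0 pJ Ja ra gena.
have m2 : (2 <= m)%N by apply: matched_ge mm _; apply: golden_right; lra.
by rewrite M3 N3; case: b {mm} => -[]; lia.
Qed.

(** The implication holds vacuously at g and at 1, as it should: both belong to the bifurcation
    set. *)
Lemma bifurcation_good a : golden R <= a <= 1 ->
  bifurcation_set R a <-> (regular a -> good a).
Proof.
have gb := golden_bounds => ag; split.
  move=> [_ nm] ra; apply: contrapT => /not_good_matched[b [m mm]].
  by apply: nm; exact: matched_in_matching_set mm.
move=> good_a; split; first by rewrite /= in_itv/=; lra.
move=> [M [N [J [M0 N0 [pJ _] Ja]]]].
have [e|ng] := eqVneq a (golden R).
  by move: Ja; rewrite e; exact: golden_not_pre_matching pJ.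
have [e|n1] := eqVneq a 1.
  have [[_ J01] [oJ _] _ _] := pJ; rewrite e in Ja.
  have [d d0 hd] := near_segment (open_nbhs_nbhs (conj oJ Ja)).
  have /J01 : J (1 + d / 2) by apply: hd; lra.
  by rewrite /= in_itv/= => /andP[_]; lra.
have ra : regular a.
  by apply: regular_golden; rewrite !lt_neqAle n1 eq_sym ng.
by have := good_not_pre_matching M0 N0 pJ Ja ra (good_a ra).
Qed.

End MatchingSet.

Lemma range1 (P : nat -> Prop) m : P m -> forall j, (m <= j < m.+1)%N -> P j.
Proof. by move=> Pm j jm; rewrite (_ : j = m) //; lia. Qed.

Lemma range2 (P : nat -> Prop) m : P m -> P m.+1 ->
  forall j, (m <= j < m.+2)%N -> P j.
Proof. by move=> P0 P1 j jm; have [->|->] : j = m \/ j = m.+1 by lia. Qed.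

Lemma range3 (P : nat -> Prop) m : P m -> P m.+1 -> P m.+2 ->
  forall j, (m <= j < m.+3)%N -> P j.
Proof. by move=> P0 P1 P2 j jm; have [->|[->|->]] : j = m \/ j = m.+1 \/ j = m.+2 by lia. Qed.

(** * Comparison with the Gauss orbit *)

Section Gauss.
Context {R : realType}.
Implicit Types (a x y u v p : R) (n k t : nat).
Local Notation T := tanaka_ito.

Definition eqZ x y := exists m : int, x - y = m%:~R.

Lemma eqZ_T a b x y : x != 0 -> y != 0 -> eqZ x^-1 y^-1 -> eqZ (T a x) (T b y).
Proof.
move=> x0 y0 [m e].
have [k [ek _]] := tanaka_ito_spec a x0; have [l [el _]] := tanaka_ito_spec b y0.
have xV : x^-1 = T a x + k%:~R by apply: (mulIf x0); rewrite mulVf.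
have yV : y^-1 = T b y + l%:~R by apply: (mulIf y0); rewrite mulVf.
exists (m - k + l); rewrite intrD intrB -e xV yV; ring.
Qed.

Lemma eqZ_TN a b x y : x != 0 -> y != 0 -> eqZ x^-1 (- y^-1) -> eqZ (T a x) (- T b y).
Proof.
move=> x0 y0 [m e].
have [k [ek _]] := tanaka_ito_spec a x0; have [l [el _]] := tanaka_ito_spec b y0.
have xV : x^-1 = T a x + k%:~R by apply: (mulIf x0); rewrite mulVf.
have yV : y^-1 = T b y + l%:~R by apply: (mulIf y0); rewrite mulVf.
exists (m - k - l); rewrite !intrB -e xV yV; ring.
Qed.

Lemma linked_eqZ a p q : linked a p q -> eqZ (T a p) (T 1 p) /\ eqZ (T a q) (- T 1 p).
Proof.
case=> e _ _; have [p0|p0] := eqVneq p 0.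
  have q0 : q = 0 by move: e; rewrite p0; lra.
  by rewrite p0 q0 !tanaka_ito0; split; exists 0; rewrite !oppr0 addr0.
have q0 : q != 0 by apply: contra_neq p0 => q0; move: e; rewrite q0; lra.
split; first by apply: eqZ_T => //; exists 0; rewrite subrr.
apply: eqZ_TN => //; exists (-1).
have -> : q^-1 - - p^-1 = (p + q) / (p * q) by field; rewrite p0 q0.
have -> : p + q = - (p * q) by lra.
by rewrite mulNr divff ?mulf_neq0.
Qed.

Lemma linked_sym a x y : linked a x y -> linked a y x.
Proof. by case=> e h1 h2; split=> //; rewrite (addrC y) (mulrC y). Qed.

Local Notation w a n := (tanaka_ito_iter 1 n a).

Lemma gauss_range a n : 0 <= w a n.+1 < 1.
Proof.
have := @tanaka_ito_ge_lt _ 1 (w a n); rewrite -[T 1 _]/(w a n.+1).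
by move=> h; have := h ltac:(lra); lra.
Qed.

(** Seen forwards, the index counts steps and is reset to 0 by the stopping condition; this is how
    its parity is followed along the orbit. *)
Lemma P_indexS n a : P_index n.+1 a =
  if (w a n.+1 <= 1 - a) || (a <= w a n) then 0%N else (P_index n a).+1.
Proof.
rewrite /P_index /= subn0 subn1 /=; case: ifP => // _; congr S.
rewrite (iotaDl 1 0 n) find_map; apply: eq_find => k /=.
by rewrite add1n subSS.
Qed.

Definition gauss_avoids a n :=
  ~ (1 < w a n * (a + 1) /\ w a n < a) /\
  (odd (P_index n a) -> ~ (1 - a < w a n /\ w a n * (a + 1) < a)).

Definition low_at a t := forall b, low a (orb b a t).

(* The Gauss orbit and the two orbits of [T_a] run at different speeds; these are
   the times where they agree up to integers and sign. *)
Definition synchronized a k t :=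
  [/\ exists b, eqZ (orb b a t) (w a k.+1) /\ eqZ (orb (~~ b) a t) (- w a k.+1),
      ~~ odd (P_index k a) & w a k < a].

Lemma synchronized_start a : regular a -> synchronized a 1 1.
Proof.
move=> ra; have [ha a1 ga] := ra.
have w1 : w a 1 = 1 / a - 1.
  apply: (@tanaka_ito_char _ _ _ _ 1); first by rewrite /=; field; lra.
  have h1 : 1 / a < 2 by rewrite ltr_pdivrMr; lra.
  have h2 : 1 <= 1 / a by rewrite ler_pdivlMr; lra.
  by lra.
have e : 1 / a - 1 = (1 - a) / a by field; lra.
have n1 : 1 - a != 0 by rewrite gt_eqF; lra.
have n2 : (1 - a) / a != 0 by rewrite gt_eqF// divr_gt0; lra.
split.
- exists true; rewrite -[w a 2]/(T 1 (w a 1)) w1 !orbS /orb /tanaka_ito_iter /= e.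
  split; first by apply: eqZ_T => //; exists 0; rewrite subrr.
  apply: eqZ_TN => //; first by rewrite lt_eqF; lra.
  by exists (-1); field; rewrite n1; apply/andP; split; lra.
- by rewrite P_indexS lexx orbT.
- by rewrite w1 ltrBlDr ltr_pdivrMr; lra.
Qed.

Lemma eqZ_cases a x z : regular a -> a - 1 <= x < a -> 0 <= z < 1 -> eqZ x z ->
  x = (if a <= z then z - 1 else z).
Proof.
move=> [ha a1 ga] rx rz [m e].
have [|||] := @int_01 R (- m); rewrite ?intrN -?e; [lra|lra|move=> h..].
  have {}e : x = z by move: e; rewrite -[m]opprK h oppr0; lra.
  by case: leP => ?; lra.
have {}e : x = z - 1 by move: e; rewrite -[m]opprK h intrN; lra.
by case: leP => ?; lra.
Qed.

Lemma eqZN_cases a y z : regular a -> a - 1 <= y < a -> 0 <= z < 1 -> eqZ y (- z) ->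
  y = (if z <= 1 - a then - z else 1 - z).
Proof.
move=> [ha a1 ga] ry rz [m]; rewrite opprK => e.
have [|||] := @int_01 R m; rewrite -?e; [lra|lra|move=> h..].
  have {}e : y = - z by move: e; rewrite h; lra.
  by case: leP => ?; lra.
have {}e : y = 1 - z by move: e; rewrite h; lra.
by case: leP => ?; lra.
Qed.

(** With $z$ the Gauss point at time [k.+1], congruence and range fix the pair: $(z,-z)$ if $z \le
    1-a$, $(z-1,1-z)$ if $z \ge a$, and $(z,1-z)$ in between. Only in the last case can a point fail
    to be low at time [t]. There the index is odd, as it was even and is not reset, and
    [gauss_avoids] says exactly that $z$ and $1-z$ are low. *)
Lemma synchronized_step a k t : regular a -> synchronized a k t ->
  gauss_avoids a k.+1 \/ low_at a t ->
  exists k' t', [/\ (k < k')%N, (t < t')%N, synchronized a k' t',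
    forall i, (k < i <= k')%N -> gauss_avoids a i &
    forall j, (t <= j < t')%N -> low_at a j].
Proof.
move=> ra [[b [xw yw]] evP wk]; have [ha a1 ga] := ra.
have wr := gauss_range a k.
have xE := eqZ_cases ra (orb_range b t ra) wr xw.
have yE := eqZN_cases ra (orb_range (~~ b) t ra) wr yw.
have lowP j : low a (orb b a j) -> low a (orb (~~ b) a j) -> low_at a j.
  by move=> h1 h2 b'; have [->|->] : b' = b \/ b' = ~~ b by case: (b) (b') => -[]; auto.
set z := w a k.+1 in xw yw wr xE yE *.
have wS n : w a n.+1 = T 1 (w a n) by [].
move=> av; have [z1|z1] := lerP z (1 - a).
  have za : z < a by lra.
  rewrite leNgt za /= in xE; rewrite z1 in yE.
  have P0 : P_index k.+1 a = 0%N by rewrite P_indexS z1.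
  exists k.+1, t.+1; split=> //.
  - split; [exists b|by rewrite P0|exact: za].
    rewrite !orbS xE yE wS -/z; have [->|z0] := eqVneq z 0.
      by rewrite oppr0 !tanaka_ito0; split; exists 0; rewrite !oppr0 addr0.
    split; [apply: eqZ_T|apply: eqZ_TN]; rewrite ?oppr_eq0 ?invrN //.
      by exists 0; rewrite subrr.
    by exists 0; rewrite subrr.
  - by apply: range1; split; [move=> [h1 _]; move: h1; rewrite -/z; nra|rewrite P0].
  - by apply: range1; apply: lowP; rewrite /low ?xE ?yE; nra.
(* For $z \ge a$ the Gauss map takes an extra step through $(1-z)/z$, whose reciprocal is
   $1/(1-z)-1$; the two orbits exchange roles. *)
have [za|za] := lerP a z.
  rewrite za in xE; rewrite leNgt z1 /= in yE.
  have zp : 0 < z by lra.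
  have z1p : 0 < 1 - z by lra.
  have w2 : w a k.+2 = (1 - z) / z.
    rewrite wS -/z; apply: (@tanaka_ito_char _ _ _ _ 1); first by field; lra.
    by rewrite ler_pdivlMr// ltr_pdivrMr//; lra.
  have P0 : P_index k.+2 a = 0%N by rewrite P_indexS -/z za orbT.
  have pl : (1 - z) / z * (a + 1) <= 1 by rewrite mulrAC ler_pdivrMr//; nra.
  exists k.+2, t.+1; split=> //.
  - split; [exists (~~ b)|by rewrite P0|].
      rewrite negbK wS w2 !orbS xE yE.
      have n1 : 1 - z != 0 by rewrite gt_eqF.
      have n2 : (1 - z) / z != 0 by rewrite gt_eqF// divr_gt0.
      have n3 : z - 1 != 0 by rewrite -opprB oppr_eq0.
      split; [apply: eqZ_T|apply: eqZ_TN] => //.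
        by exists 1; field; lra.
      by exists (-1); field; lra.
    by rewrite w2 ltr_pdivrMr//; nra.
  - apply: range2; last by split; [rewrite w2; lra|rewrite P0].
    by split=> [[_]|_ [_]]; rewrite -/z; nra.
  - by apply: range1; apply: lowP; rewrite /low ?xE ?yE; nra.
rewrite leNgt za /= in xE; rewrite leNgt z1 /= in yE.
have oddP : odd (P_index k.+1 a).
  by rewrite P_indexS -/z !leNgt z1 wk /=.
have [lz ly] : low a z /\ low a (1 - z).
  case: av => [[h1 h2]|h]; last by have := h b; have := h (~~ b); rewrite xE yE.
  rewrite /low; split; rewrite leNgt; apply/negP => h; first exact: h1.
  by apply: (h2 oddP); rewrite -/z; split=> //; lra.
have z10 : z + (1 - z) = 1 by lra.
have [z0 Tz] := T_middle ra lz ly z10.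
have [y0 Ty] := T_middle ra ly lz (etrans (addrC _ _) z10).
have lk := sum1_step ra lz ly z10.
have low1 : low_at a t.+1.
  apply: lowP; rewrite orbS ?xE ?yE; apply: ltW; first exact: linked_lt lk.
  exact: linked_lt (linked_sym lk).
have lowt : low_at a t by apply: lowP; rewrite ?xE ?yE.
have avk : gauss_avoids a k.+1.
  by split=> [|_]; rewrite -/z => -[]; move: lz ly; rewrite /low; lra.
have lowt2 := range2 lowt low1.
have small p q : linked a p q -> p < a /\ p * (a + 1) < 1.
  by move=> l; split; [case: l => _ h _; nra|exact: linked_lt l].
(* Both points have digit 2 under $T_a$. For $z \le 1/2$ so does $z$ under the Gauss map, and two
   steps restore an even index. *)
have [zh|zh] := lerP z (1 / 2).
  have w2 : w a k.+2 = T a z.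
    rewrite wS -/z; apply: (@tanaka_ito_char _ _ _ _ 2) => //.
    have [h _] := small _ _ lk.
    by apply/andP; split; nra.
  have evP2 : ~~ odd (P_index k.+2 a).
    by rewrite P_indexS; case: ifP => //= _; rewrite oddP.
  have [h1 h2] := small _ _ lk.
  exists k.+2, t.+2; split=> //.
  - split=> //; last by rewrite w2.
    exists b; rewrite wS w2 [orb b a t.+2]orbS [orb (~~ b) a t.+2]orbS !orbS xE yE.
    exact: linked_eqZ lk.
  - apply: range2 => //.
    by split; [rewrite w2; lra|rewrite (negbTE evP2)].
(* For $z > 1/2$ the Gauss map uses two digits 1 to reach $T_a(1-z)$. The intermediate point is at
   least [a] because $z$ is low, which resets the index. *)
have w2 : w a k.+2 = (1 - z) / z.
  rewrite wS -/z; apply: (@tanaka_ito_char _ _ _ _ 1); first by field; lra.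
  by rewrite ler_pdivlMr// ltr_pdivrMr//; lra.
have w2a : a <= w a k.+2 by rewrite w2 ler_pdivlMr//; move: lz; rewrite /low; lra.
have [h1 h2] := small _ _ (linked_sym lk).
have w3 : w a k.+3 = T a (1 - z).
  rewrite wS w2; apply: (@tanaka_ito_char _ _ _ _ 1).
    have TE : T a (1 - z) = (1 - 2 * (1 - z)) / (1 - z).
      by apply: (mulIf (lt0r_neq0 y0)); rewrite divfK ?gt_eqF//; lra.
    by rewrite TE; field; lra.
  by apply/andP; split; nra.
have P0 : P_index k.+3 a = 0%N by rewrite P_indexS w2a orbT.
exists k.+3, t.+2; split=> //; first exact: ltn_trans (leqnSn _).
- split; [|by rewrite P0|by rewrite w3].
  exists (~~ b); rewrite negbK wS w3 [orb b a t.+2]orbS [orb (~~ b) a t.+2]orbS !orbS xE yE.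
  exact: linked_eqZ (linked_sym lk).
- apply: range3 => //; last by split; [rewrite w3; lra|rewrite P0].
  by split=> [[_]|_ [_]]; nra.
Qed.

Lemma gauss_avoids_good a : regular a ->
  (forall n, (2 <= n)%N -> gauss_avoids a n) <-> good a.
Proof.
move=> ra; have ss := synchronized_start ra.
have l0 : low_at a 0 by move=> b; exact: orb0_low.
split=> [av|ga].
  have H m : exists k t, [/\ (m <= t)%N, (0 < k)%N, synchronized a k t &
      forall j, (j < t)%N -> low_at a j].
    elim: m => [|m [k [t [mt k0 sk lt]]]].
      by exists 1%N, 1%N; split=> // -[].
    have [|k' [t' [kk tt sk' _ lt']]] := synchronized_step ra sk; first by left; exact: av.
    exists k', t'; split=> //; [lia|lia|] => j jt.
    by have [jt'|jt'] := ltnP j t; [exact: lt|apply: lt'; rewrite jt'].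
  move=> m b j jm; have [k [t [mt _ _ lt]]] := H m.
  by apply: lt; lia.
have H m : exists k t, [/\ (m <= k)%N, synchronized a k t &
    forall i, (1 < i <= k)%N -> gauss_avoids a i].
  elim: m => [|m [k [t [mk sk avk]]]].
    by exists 1%N, 1%N; split=> // i; lia.
  have lt : low_at a t by move=> b; exact: (ga t.+1).
  have [|k' [t' [kk tt sk' av' _]]] := synchronized_step ra sk; first by right.
  exists k', t'; split=> //; [lia|] => i /andP[i1 ik].
  by have [ki|ki] := leqP i k; [apply: avk; rewrite i1|apply: av'; rewrite ki].
move=> n n2; have [k [t [mk _ avk]]] := H n.
by apply: avk; rewrite n2.
Qed.

End Gauss.

(** * Comparison with the orbits of $T_g$ *)

Section Golden.
Context {R : realType}.
Implicit Types a x : R.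

(** Each condition puts the orbit in $[a-1, g)$, common to both ranges, so the two maps agree along
    it; the bound at g uses $1/(g+1)=g$. Conversely, a value in $(1/(a+1), g)$ has digit 2 under
    $T_g$ and is sent below $a-1$. *)
Lemma iter_golden_low a x : golden R <= a <= 1 ->
  (forall n, (1 <= n)%N -> low a (tanaka_ito_iter a n x)) <->
  (forall n, (1 <= n)%N -> a - 1 <= tanaka_ito_iter (golden R) n x).
Proof.
have ge := @golden_eq R; have gb := @golden_bounds R => ag.
have ra y : a - 1 <= tanaka_ito a y < a by apply: tanaka_ito_ge_lt; lra.
have rg y : golden R - 1 <= tanaka_ito (golden R) y < golden R.
  by apply: tanaka_ito_ge_lt; lra.
split=> h.
  have e n : tanaka_ito_iter (golden R) n x = tanaka_ito_iter a n x.
    elim: n => //= n IH; rewrite -!/(tanaka_ito_iter _ n x) IH.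
    set y := tanaka_ito_iter a n x.
    have [->|/(tanaka_ito_spec a)[m [em _]]] := eqVneq y 0; first by rewrite !tanaka_ito0.
    apply: (tanaka_ito_char em).
    have := ra y; have := h n.+1 isT.
    by rewrite /low -[tanaka_ito_iter a n.+1 x]/(tanaka_ito a y) => *; apply/andP; split; nra.
  by move=> [//|n] _; rewrite e; have /andP[] := ra (tanaka_ito_iter a n x).
have e n : tanaka_ito_iter (golden R) n x = tanaka_ito_iter a n x.
  elim: n => //= n IH; rewrite -!/(tanaka_ito_iter _ n x) -IH.
  set y := tanaka_ito_iter (golden R) n x.
  have [->|/(tanaka_ito_spec (golden R))[m [em _]]] := eqVneq y 0.
    by rewrite !tanaka_ito0.
  symmetry; apply: (tanaka_ito_char em); have := rg y; have := h n.+1 isT.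
  by rewrite -[tanaka_ito_iter _ n.+1 x]/(tanaka_ito (golden R) y); lra.
move=> [//|n] _; rewrite -e /low leNgt; apply/negP => hi.
set y := tanaka_ito_iter (golden R) n.+1 x in hi.
have yg : y < golden R by have /andP[] := rg (tanaka_ito_iter (golden R) n x).
have y0 : 0 < y by rewrite -(pmulr_lgt0 _ (_ : 0 < a + 1)); lra.
have V1 : golden R + 1 <= y^-1 by rewrite -div1r ler_pdivlMr//; nra.
have V2 : y^-1 < a + 1 by rewrite -div1r ltr_pdivrMr//; lra.
have Ty : tanaka_ito (golden R) y = y^-1 - 2.
  apply: (@tanaka_ito_char _ _ _ _ 2); first by rewrite subrK mulVf// gt_eqF.
  by lra.
have := h n.+2 isT; rewrite -[tanaka_ito_iter _ n.+2 x]/(tanaka_ito (golden R) y) Ty.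
by lra.
Qed.

Lemma good_orbits_low a : golden R <= a <= 1 ->
  (regular a -> good a) <->
  (forall n, (1 <= n)%N -> low a (tanaka_ito_iter a n (a - 1)) /\
    low a (tanaka_ito_iter a n (1 / a - 1))).
Proof.
have ge := @golden_eq R; have gb := @golden_bounds R => ag.
split=> [ga n n1|h ra m b [|j] _]; last first.
- by have [h1 h2] := h j.+1 isT; case: b.
- exact: orb0_low.
have [ag'|ng] := eqVneq a (golden R).
  have low_T y : low a (tanaka_ito a y).
    by have := @tanaka_ito_ge_lt _ a y ltac:(lra); rewrite /low; nra.
  by case: n n1 => // n _; split; exact: low_T.
have [->|na1] := eqVneq a 1.
  have z k : tanaka_ito_iter 1 k 0 = 0 :> R.
    by elim: k => //= k IH; rewrite -/(tanaka_ito_iter 1 k 0) IH tanaka_ito0.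
  by rewrite divr1 subrr z /low mul0r ler01.
have ra : regular a by apply: regular_golden; rewrite !lt_neqAle na1 eq_sym ng.
by split; [exact: (ga ra n.+1 false)|exact: (ga ra n.+1 true)].
Qed.

End Golden.

Theorem theorem1p3 (R : realType) :
  let g : R := golden R in
  let A1 : set R := [set a | a \in `[g, 1] /\
    forall n : nat, (1 <= n)%N ->
      tanaka_ito_iter a n (a - 1) <= 1 / (a + 1) /\
      tanaka_ito_iter a n (1 / a - 1) <= 1 / (a + 1)] in
  let A2 : set R := [set a | a \in `[g, 1] /\
    forall n : nat, (1 <= n)%N ->
      a - 1 <= tanaka_ito_iter g n (a - 1) /\
      a - 1 <= tanaka_ito_iter g n (1 / a - 1)] in
  let A3 : set R := [set a | a \in `[g, 1] /\
    (forall n : nat, (2 <= n)%N ->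
      tanaka_ito_iter 1 n a \notin `]1 / (a + 1), a[) /\
    (forall n : nat, (2 <= n)%N -> odd (P_index n a) ->
      tanaka_ito_iter 1 n a \notin `]1 - a, a / (a + 1)[)] in
  bifurcation_set R `&` `[g, 1] = A1 /\ A1 = A2 /\ A2 = A3.
Proof.
move=> g A1 A2 A3.
have gb := @golden_bounds R; have ge := @golden_eq R; rewrite -/g in gb ge.
have gP a : a \in `[g, 1] <-> g <= a <= 1 by rewrite in_itv.
have lowE a x : g <= a <= 1 -> (x <= 1 / (a + 1)) = (x * (a + 1) <= 1).
  by move=> ag; rewrite ler_pdivlMr//; lra.
have A1P a : A1 a <-> g <= a <= 1 /\ (regular a -> good a).
  split=> [[/gP ag h]|[ag /(good_orbits_low ag) h]]; split=> //; last first.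
    by move=> n /h; rewrite !lowE.
  by apply/(good_orbits_low ag) => n /h; rewrite !lowE.
have A2P a : A2 a <-> g <= a <= 1 /\ (regular a -> good a).
  have E ag x := @iter_golden_low R a x ag.
  split=> [[/gP ag h]|[ag /(good_orbits_low ag) h]]; split=> //; last first.
    by move=> n n1; split; [apply: ((E ag (a - 1)).1 _ n n1)|apply: ((E ag (1 / a - 1)).1 _ n n1)] => k /h[].
  apply/(good_orbits_low ag) => n n1.
  by split; [apply: ((E ag (a - 1)).2 _ n n1)|apply: ((E ag (1 / a - 1)).2 _ n n1)] => k /h[].
have A3P a : A3 a <-> g <= a <= 1 /\ (regular a -> good a).
  split=> [[/gP ag [h1 h2]]|[ag h]]; split=> //; last first.
  - suff av n : (2 <= n)%N -> (tanaka_ito_iter 1 n a \notin `]1 / (a + 1), a[) /\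
      (odd (P_index n a) -> tanaka_ito_iter 1 n a \notin `]1 - a, a / (a + 1)[).
      by split=> n n2; have [] := av n n2.
    move=> n2; rewrite !in_itv/= ltr_pdivrMr ?ltr_pdivlMr; [|lra|lra].
    have [ra|nra] := pselect (regular a).
      have [av1 av2] := (gauss_avoids_good ra).2 (h ra) n n2.
      split=> [|/av2 av2']; apply/negP => /andP[? ?]; [exact: av1|exact: av2'].
    (* At g both intervals are empty, since $1/(g+1)=g$ and $g/(g+1)=1-g$; at 1 the Gauss orbit is
       0, outside both. *)
    have [ea|ea] : a = g \/ a = 1.
      have [?|n1] := eqVneq a g; [by left|right; apply: contrapT => n3].
      apply: nra; apply: regular_golden; rewrite !lt_neqAle -/g eq_sym n1.
      by case/andP: ag => -> ->; rewrite !andbT; apply/eqP.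
    + by split=> [|_]; apply/negP => /andP[]; rewrite ea; nra.
    + rewrite ea; have : tanaka_ito_iter 1 n (1 : R) = 0.
        elim: n n2 => [//|[//|[_ _|n IH _]]].
        - rewrite /tanaka_ito_iter /= [tanaka_ito 1 1](_ : _ = 0) ?tanaka_ito0//.
          by apply: (@tanaka_ito_char _ _ _ _ 1); lra.
        - by rewrite -[LHS]/(tanaka_ito 1 (tanaka_ito_iter 1 n.+2 1)) IH ?tanaka_ito0.
      by move=> ->; rewrite mul0r ltr10 subrr ltxx.
  move=> ra; apply/(gauss_avoids_good ra) => n n2.
  have := h2 n n2; have := h1 n n2; rewrite !in_itv/= ltr_pdivrMr ?ltr_pdivlMr; [|lra|lra].
  move=> k1 k2; split=> [[l1 l2]|/k2 k2' [l1 l2]]; first by rewrite l1 l2 in k1.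
  by rewrite l1 l2 in k2'.
split; [|split]; apply/seteqP; split=> a.
- move=> [bif /gP ag]; apply/A1P; split=> //.
  exact/(bifurcation_good ag).
- move=> /A1P[ag h]; split; last exact/gP.
  exact/(bifurcation_good ag).
- by move=> /A1P/A2P.
- by move=> /A2P/A1P.
- by move=> /A2P/A3P.
- by move=> /A3P/A2P.
Qed.
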